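(* Let $X$ be an infinite dimensional Banach space, let $(\varepsilon_n)_{n\ge 0}$ be a sequence of positive real numbers decreasing to $0$, and let $f:\mathbb{N}\to\mathbb{N}$ be any function. Then there is a subspace $Y\subset X$ with the following properties: (1) $Y$ has a normalized basis $(y_n)_{n=1}^\infty$ with basis constant $\le 1+\varepsilon_0$. (2) For every $n\ge 1$, every subspace $E\subset \operatorname{span}_{n\le i<\infty} y_i$ with $\dim E\le f(n)$ is $(1+\varepsilon_n)$-isomorphic to a Banach space $F$ such that $F$ almost isometrically embeds into every infinite dimensional subspace of $Y$. (3) For every $n\ge 1$, every block basis $(z_i)_{i=1}^{f(n)}$ of $(y_i)_{i=n}^\infty$ is $(1+\varepsilon_n)$-equivalent to a basis $\{w_i\}_{i=1}^{f(n)}$ of a Banach space $F$ such that $\{w_i\}_{i=1}^{f(n)}$ is almost isometrically equivalent to a block basis of every basic sequence in $Y$.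
   Context: $\mathbb{N}=\{1,2,\ldots\}$. Subspaces are closed linear subspaces and $\operatorname{span}_{n\le i<\infty} y_i$ is the closed linear span of $\{y_i: i\ge n\}$. ''Basis'' means Schauder basis. Two Banach spaces $E,F$ are $C$-isomorphic if there is an isomorphism $T$ of $E$ onto $F$ with $\|T\|\,\|T^{-1}\|\le C$. A Banach space $F$ almost isometrically embeds into a Banach space $W$ if for every $\varepsilon>0$ there is a subspace $Z\subset W$ and an isomorphism $T:F\to Z$ onto $Z$ with $\|T\|\,\|T^{-1}\|\le 1+\varepsilon$. Two sequences $(u_i)$, $(v_i)$ (indexed by the same set) are $C$-equivalent if there are constants $A,B>0$ with $AB\le C$ such that $A^{-1}\|\sum a_i v_i\|\le\|\sum a_i u_i\|\le B\|\sum a_i v_i\|$ for all finitely supported scalar sequences $(a_i)$. A (finite or infinite) block basis of a basic sequence $(u_j)$ is a sequence of nonzero vectors $z_i=\sum_{j=p_i+1}^{p_{i+1}} a_j u_j$ with $p_1<p_2<\cdots$. A finite sequence $\{w_i\}_{i=1}^m$ is almost isometrically equivalent to a block basis of a basic sequence $(u_j)$ if for every $\varepsilon>0$ there is a block basis $(z_i)_{i=1}^m$ of $(u_j)$ that is $(1+\varepsilon)$-equivalent to $\{w_i\}_{i=1}^m$. *)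

(* Defs.v *)
From mathcomp Require Import all_boot all_order all_algebra.
From mathcomp Require Import all_classical all_reals all_analysis.
From mathcomp Require Import complex.

Set Implicit Arguments.
Unset Strict Implicit.
Unset Printing Implicit Defensive.

Import Order.TTheory GRing.Theory Num.Theory.
Import numFieldNormedType.Exports.

Local Open Scope classical_set_scope.
Local Open Scope ring_scope.

(* Banach spaces are complete normed modules over K, where K is the field of
   real or of complex numbers.  Norms and real constants live in K itself; in
   the complex case x <= y means that y - x is a nonnegative real, so that
   0 < x says that x is a positive real number. *)
Variant real_or_complex (R : realType) : numFieldType -> Prop :=
| RealScalars : real_or_complex R R
| ComplexScalars : real_or_complex R R[i].

Section Subspaces.
Context {K : numFieldType} {V : normedModType K}.

Definition linear_subset (E : set V) : Prop :=
  E 0 /\ forall (a : K) (u v : V), E u -> E v -> E (a *: u + v).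

Definition closed_subspace (E : set V) : Prop := linear_subset E /\ closed E.

Definition linear_span (S : set V) : set V :=
  [set x | exists (m : nat) (a : 'I_m -> K) (v : 'I_m -> V),
     (forall i, S (v i)) /\ x = \sum_(i < m) a i *: v i].

Definition closed_span (S : set V) : set V := closure (linear_span S).

Definition lin_indep (m : nat) (v : 'I_m -> V) : Prop :=
  forall a : 'I_m -> K, \sum_(i < m) a i *: v i = 0 -> forall i, a i = 0.

Definition finite_basis (m : nat) (v : 'I_m -> V) (E : set V) : Prop :=
  lin_indep v /\ linear_span (range v) = E.

Definition dim_eq (E : set V) (k : nat) : Prop :=
  exists v : 'I_k -> V, finite_basis v E.

Definition dim_le (E : set V) (d : nat) : Prop :=
  exists2 k : nat, (k <= d)%N & dim_eq E k.

Definition infinite_dim (E : set V) : Prop := ~ exists k : nat, dim_eq E k.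

Definition schauder_basis (y : nat -> V) (Y : set V) : Prop :=
  (forall i, Y (y i)) /\
  forall x, Y x -> exists! a : nat -> K, series (fun i => a i *: y i) @ \oo --> x.

(* The basis constant is the supremum of the norms of the partial sum
   projections x = \sum_i a i *: y i |-> \sum_(i < m) a i *: y i. *)
Definition basis_constant_le (y : nat -> V) (C : K) : Prop :=
  forall (a : nat -> K) (x : V), series (fun i => a i *: y i) @ \oo --> x ->
    forall m : nat, `|\sum_(i < m) a i *: y i| <= C * `|x|.

Definition basic_sequence (u : nat -> V) : Prop :=
  schauder_basis u (closed_span (range u)).

(* Sequences are indexed from 0, so the block p_i < j <= p_(i+1) of a sequence
   indexed from 1 becomes p i <= j < p i.+1. *)
Definition block_basis (u : nat -> V) (m : nat) (z : 'I_m -> V) : Prop :=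
  exists (p : nat -> nat) (a : nat -> K),
    (forall i, (p i < p i.+1)%N) /\
    forall i : 'I_m, z i = \sum_(p i <= j < p i.+1) a j *: u j /\ z i != 0.

End Subspaces.

Section Isomorphisms.
Context {K : numFieldType}.

Definition linear_on {V W : normedModType K} (E : set V) (T : V -> W) : Prop :=
  forall (a : K) (u v : V), E u -> E v -> T (a *: u + v) = a *: T u + T v.

Definition unit_ball_norms {V W : normedModType K} (E : set V) (T : V -> W) :
    set K :=
  [set `|T x| | x in [set x | E x /\ `|x| <= 1]].

Definition bounded_on {V W : normedModType K} (E : set V) (T : V -> W) : Prop :=
  has_ubound (unit_ball_norms E T).

Definition opnorm {V W : normedModType K} (E : set V) (T : V -> W) : K :=
  supremum 0 (unit_ball_norms E T).

(* Operators between subspaces are represented by functions on the ambient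
   spaces whose values outside the subspaces are irrelevant; S is the inverse
   of T. *)
Definition isomorphic {V W : normedModType K} (C : K) (E : set V) (F : set W) :
    Prop :=
  exists (T : V -> W) (S : W -> V),
    [/\ linear_on E T,
        (forall x, E x -> F (T x) /\ S (T x) = x),
        (forall y, F y -> E (S y) /\ T (S y) = y),
        bounded_on E T /\ bounded_on F S &
        opnorm E T * opnorm F S <= C].

Definition almost_isometrically_embeds {V W : normedModType K}
    (F : set V) (G : set W) : Prop :=
  forall e : K, 0 < e ->
    exists Z : set W, [/\ closed_subspace Z, Z `<=` G & isomorphic (1 + e) F Z].

Definition seq_equivalent {V W : normedModType K} (C : K) (m : nat)
    (u : 'I_m -> V) (v : 'I_m -> W) : Prop :=
  exists A B : K, [/\ 0 < A, 0 < B, A * B <= C &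
    forall a : 'I_m -> K,
      A^-1 * `|\sum_(i < m) a i *: v i| <= `|\sum_(i < m) a i *: u i| /\
      `|\sum_(i < m) a i *: u i| <= B * `|\sum_(i < m) a i *: v i|].

Definition almost_isometrically_equivalent_to_block {V W : normedModType K}
    (m : nat) (w : 'I_m -> V) (u : nat -> W) : Prop :=
  forall e : K, 0 < e ->
    exists z : 'I_m -> W, block_basis u z /\ seq_equivalent (1 + e) z w.

End Isomorphisms.

(* Main.v *)
Require Import Defs.
From HB Require Import structures.
From mathcomp Require Import all_boot all_order all_algebra.
From mathcomp Require Import all_classical all_reals all_analysis.
From mathcomp Require Import complex.
From mathcomp Require Import ring lra.

Set Implicit Arguments.
Unset Strict Implicit.
Unset Printing Implicit Defensive.

Import Order.TTheory GRing.Theory Num.Theory.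
Import numFieldNormedType.Exports.

Local Open Scope classical_set_scope.
Local Open Scope ring_scope.

(* For tuples of vectors of X consider the norm they induce on K^d.  Norms coming
   from well-conditioned tuples form a totally bounded set, so they can be
   coloured with finitely many colours of small diameter.  Whether some tuple of
   a given colour occurs in (the span of, or as blocks of) a sequence is
   hereditary for block sequences, so a block sequence can be chosen that decides
   every colour: it is either absent or occurs in all further block sequences.
   A diagonal sequence y, chosen with Mazur's lemma to be a nearly monotone basic
   sequence, decides finer and finer colourings of longer and longer tuples on its
   tails.  A tuple in the n-th tail is then followed by tuples in later tails with
   ever closer norms; the limit norm on K^d defines F, and F is found with
   arbitrary precision in each block sequence of y, hence, by a gliding hump, in
   each infinite dimensional subspace and each basic sequence of Y. *)

(** * Norms, segments and block sequences *)

(** Shapes are compared with additive errors measured against [l1norm], because such errors add up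
    along limits and perturbations; the lower bound [adm_cst d * l1norm] converts them into factors
    [1 + e] at the end. Tuples must therefore be well conditioned with a constant that depends on
    [d] alone: a subspace gets such a basis from Riesz's lemma, unit blocks get it from the basis
    constant. One colour fixes a shape only up to its diameter; a single [F] that serves all targets
    and all precisions has to be a limit. The tolerances at least halve at each stage, so the limit
    norm stays within [2 * dl s] of the shape it starts from. Deciding concerns block sequences of
    [y] only; other independent sequences in [Y] are reached because suitable combinations of their
    vectors lose any given number of leading coordinates. Norms are real valued and convergence is
    geometric throughout, so that real and complex scalars share one argument. *)

Lemma dependent_choice_inv (T : Type) (inv : nat -> T -> Prop)
    (step : nat -> T -> T -> Prop) (x0 : T) : inv 0%N x0 ->
  (forall n x, inv n x -> exists2 y, inv n.+1 y & step n x y) ->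
  exists2 g : nat -> T, g 0%N = x0 & forall n, inv n (g n) /\ step n (g n) (g n.+1).
Proof.
move=> i0 next.
have next' (nx : nat * T) : exists y, inv nx.1 nx.2 -> inv nx.1.+1 y /\ step nx.1 nx.2 y.
  case: (pselect (inv nx.1 nx.2)) => [/next[y iy sy]|ni]; first by exists y.
  by exists nx.2 => /ni.
have [h hP] := choice next'.
pose g := fix g n := if n is m.+1 then h (m, g m) else x0.
have ginv n : inv n (g n) by elim: n => //= n IH; case: (hP (n, g n) IH).
by exists g => // n; split=> //; case: (hP (n, g n) (ginv n)).
Qed.

Section Halves.
Context {R : realType}.
Implicit Types x M : R.

Lemma half_gt0 t : 0 < (2^-1 : R) ^+ t.
Proof. by rewrite exprn_gt0 // invr_gt0 ltr0n. Qed.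

Lemma halfS t : (2^-1 : R) ^+ t.+1 = 2^-1 ^+ t / 2.
Proof. by rewrite exprSr. Qed.

Lemma half_le s t : (s <= t)%N -> (2^-1 : R) ^+ t <= 2^-1 ^+ s.
Proof. by move=> st; apply: ler_wiXn2l => //; lra. Qed.

Lemma half_small x : 0 < x -> exists t, (2^-1 : R) ^+ t <= x.
Proof.
move=> x0; have x0' : 0 <= x^-1 by rewrite invr_ge0 ltW.
have := archi_boundP x0'; set n := Num.bound _ => xn; exists n.
have n2 : n%:R <= (2 : R) ^+ n by rewrite -natrX ler_nat ltnW // ltn_expl.
rewrite exprVn -[leRHS]invrK lef_pV2 ?posrE ?invr_gt0 ?exprn_gt0 //.
by rewrite ltW // (lt_le_trans xn).
Qed.

(** Stands in for passage to the limit: an inequality between limits of geometrically convergent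
    sequences is proved by bounding its defect at every stage [t]. *)
Lemma half_le0 M x : (forall t, x <= M * 2^-1 ^+ t) -> x <= 0.
Proof.
move=> xM; rewrite leNgt; apply/negP => x0.
have M0 : 0 < M by rewrite (lt_le_trans x0) // (le_trans (xM 0%N)) // expr0 mulr1.
have [t ht] := half_small (divr_gt0 x0 (mulr_gt0 (ltr0n R 2) M0)).
have := xM t; rewrite leNgt => /negP; apply.
have /le_lt_trans : M * 2^-1 ^+ t <= M * (x / (2 * M)) by rewrite ler_pM2l.
apply; have -> : M * (x / (2 * M)) = x / 2 by field; rewrite gt_eqF.
by lra.
Qed.

End Halves.

(** The modulus of the real or complex field, with real values. Completeness is asked for geometric
    sequences, the kind that the constructions produce; the factor 4 is the sum of the errors 2 of
    the real and imaginary parts. *)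
Record scalar_abs (R : realType) (K : fieldType) := ScalarAbs {
  kn :> K -> R;
  kn_ge0 : forall a, 0 <= kn a;
  kn0 : kn 0 = 0;
  kn_nat : forall n, kn n%:R = n%:R;
  kn0_eq : forall a, kn a = 0 -> a = 0;
  knM : forall a b, kn (a * b) = kn a * kn b;
  knD : forall a b, kn (a + b) <= kn a + kn b;
  kn_onto : forall r, 0 <= r -> exists a, kn a = r;
  kn_complete : forall (u : nat -> K) (M : R), 0 <= M ->
    (forall t, kn (u t.+1 - u t) <= M * 2^-1 ^+ t) ->
    exists l, forall t, kn (u t - l) <= 4 * M * 2^-1 ^+ t;
  kn_tb : forall r d : R, 0 < d -> exists (T : finType) (col : K -> T),
    forall x y, kn x <= r -> kn y <= r -> col x = col y -> kn (x - y) <= d }.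

Record vnorm (R : realType) (K : fieldType) (kn : scalar_abs R K)
    (V : lmodType K) := VNorm {
  nv :> V -> R;
  nvD : forall x y, nv (x + y) <= nv x + nv y;
  nvZ : forall a x, nv (a *: x) = kn a * nv x;
  nv0_eq : forall x, nv x = 0 -> x = 0 }.

Section Norms.
Context {R : realType} {K : fieldType} {kn : scalar_abs R K}.
Context {V : lmodType K} (nv : vnorm kn V).
Implicit Types (x y z : V) (u w : nat -> V).

Lemma kn1 : kn 1 = 1.
Proof. exact: (kn_nat kn 1%N). Qed.

Lemma knN a : kn (- a) = kn a.
Proof.
suff n1 : kn (-1) = 1 by rewrite -mulN1r knM n1 mul1r.
have := knM kn (-1) (-1); rewrite mulrNN mulr1 kn1 => h.
have := kn_ge0 kn (-1) => h'; nra.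
Qed.

Lemma kn_gt0 a : a != 0 -> 0 < kn a.
Proof.
by move=> a0; rewrite lt_neqAle kn_ge0 andbT eq_sym; apply: contra_neq a0; apply: kn0_eq.
Qed.

Lemma nv0 : nv 0 = 0.
Proof. by rewrite -(scale0r (0 : V)) nvZ kn0 mul0r. Qed.

Lemma nvN x : nv (- x) = nv x.
Proof. by rewrite -scaleN1r nvZ knN kn1 mul1r. Qed.

Lemma nv_ge0 x : 0 <= nv x.
Proof. by have := nvD nv x (- x); rewrite subrr nv0 nvN => h; lra. Qed.

Lemma nv_gt0 x : x <> 0 -> 0 < nv x.
Proof.
move=> x0; rewrite lt_neqAle nv_ge0 andbT eq_sym; apply/eqP => h.
by apply: x0; apply: nv0_eq h.
Qed.

Lemma nvB x y : nv (x - y) <= nv x + nv y.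
Proof. by rewrite -(nvN y) nvD. Qed.

Lemma nv_sym x y : nv (x - y) = nv (y - x).
Proof. by rewrite -opprB nvN. Qed.

Lemma nvB_ge x y : nv x - nv y <= nv (x - y).
Proof. by have := nvD nv (x - y) y; rewrite subrK => h; lra. Qed.

Lemma nvB_norm x y : `|nv x - nv y| <= nv (x - y).
Proof.
by rewrite ler_norml nvB_ge andbT; have := nvB_ge y x; rewrite nv_sym => h; lra.
Qed.

Lemma nv_tri y x z : nv (x - z) <= nv (x - y) + nv (y - z).
Proof. by rewrite (le_trans _ (nvD _ _ _)) // addrA subrK. Qed.

Lemma nv_sum (I : Type) (r : seq I) (P : pred I) (F : I -> V) :
  nv (\sum_(i <- r | P i) F i) <= \sum_(i <- r | P i) nv (F i).
Proof.
elim/big_ind2: _ => [|x1 x2 y1 y2 h1 h2|//]; first by rewrite nv0.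
by rewrite (le_trans (nvD _ _ _)) // lerD.
Qed.

Lemma nv_normalize x : x <> 0 -> exists2 a, a != 0 & nv (a *: x) = 1.
Proof.
move=> x0; have nx := nv_gt0 x0.
have [a ha] := @kn_onto _ _ kn (nv x)^-1 (ltac:(by rewrite invr_ge0 ltW)).
exists a; last by rewrite nvZ ha mulVf // gt_eqF.
apply/eqP => a0; move: ha; rewrite a0 kn0 => /esym/eqP.
by rewrite invr_eq0 gt_eqF.
Qed.

Definition lincomb d (v : 'I_d -> V) (a : 'I_d -> K) : V := \sum_i a i *: v i.
Definition l1norm d (a : 'I_d -> K) : R := \sum_i kn (a i).

Lemma l1norm_ge0 d (a : 'I_d -> K) : 0 <= l1norm a.
Proof. by apply: sumr_ge0 => i _; apply: kn_ge0. Qed.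

Lemma lincomb_le d (v : 'I_d -> V) a B : (forall i, nv (v i) <= B) ->
  nv (lincomb v a) <= B * l1norm a.
Proof.
move=> vB; rewrite (le_trans (nv_sum _ _ _)) // mulr_sumr ler_sum // => i _.
by rewrite nvZ mulrC ler_wpM2r // kn_ge0.
Qed.

Lemma lincombBl d (v w : 'I_d -> V) a : lincomb v a - lincomb w a = lincomb (fun i => v i - w i) a.
Proof. by rewrite -sumrB; apply: eq_bigr => i _; rewrite scalerBr. Qed.

Lemma lincombBr d (v : 'I_d -> V) a b : lincomb v a - lincomb v b = lincomb v (fun i => a i - b i).
Proof. by rewrite -sumrB; apply: eq_bigr => i _; rewrite scalerBl. Qed.

Lemma lincomb_pert d (v w : 'I_d -> V) a B : (forall i, nv (v i - w i) <= B) ->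
  `|nv (lincomb v a) - nv (lincomb w a)| <= B * l1norm a.
Proof. by move=> vB; rewrite (le_trans (nvB_norm _ _)) // lincombBl lincomb_le. Qed.

(** * Segments, block sequences and linear independence *)

Definition seg u (m n : nat) (x : V) :=
  exists a : nat -> K, x = \sum_(m <= j < n) a j *: u j.

Lemma seg_sub u m n (S : V -> Prop) : S 0 ->
    (forall a x y, S x -> S y -> S (a *: x + y)) ->
    (forall j, (m <= j < n)%N -> S (u j)) ->
  forall x, seg u m n x -> S x.
Proof.
move=> S0 SD Su x [a ->]; rewrite big_nat_cond.
apply: (big_ind S) => // [y z Sy Sz|j /andP[mjn _]].
  by rewrite -(scale1r y); apply: SD.
by rewrite -[_ *: _]addr0; apply: SD => //; apply: Su.
Qed.

Lemma seg0 u m n : seg u m n 0.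
Proof. by exists (fun=> 0); rewrite big1 // => j _; rewrite scale0r. Qed.

Lemma segZD u m n a x y : seg u m n x -> seg u m n y -> seg u m n (a *: x + y).
Proof.
move=> [b ->] [c ->]; exists (fun j => a * b j + c j).
rewrite scaler_sumr -big_split /=; apply: eq_bigr => j _.
by rewrite scalerA scalerDl.
Qed.

Lemma segD u m n x y : seg u m n x -> seg u m n y -> seg u m n (x + y).
Proof. by move=> sx sy; rewrite -(scale1r x); apply: segZD. Qed.

Lemma segZ u m n a x : seg u m n x -> seg u m n (a *: x).
Proof. by move=> sx; rewrite -[_ *: _]addr0; apply: segZD => //; apply: seg0. Qed.

Lemma segB u m n x y : seg u m n x -> seg u m n y -> seg u m n (x - y).
Proof. by move=> sx sy; rewrite addrC -scaleN1r; apply: segZD. Qed.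

Lemma seg_mem u m n j : (m <= j < n)%N -> seg u m n (u j).
Proof.
move=> /andP[mj jn]; exists (fun i => (i == j)%:R).
rewrite (big_cat_nat _ (n := j)) ?(ltnW jn) //= (big_ltn jn) eqxx scale1r.
rewrite !big_nat !big1 ?addr0 ?add0r // => i /andP[h1 h2].
  by rewrite gtn_eqF ?scale0r.
by rewrite ltn_eqF ?scale0r.
Qed.

Lemma seg_incl u m n m' n' x : (m' <= m)%N -> (n <= n')%N -> seg u m n x -> seg u m' n' x.
Proof.
move=> mm nn; apply: seg_sub => [||j /andP[mj jn]]; [exact: seg0|exact: segZD|].
by apply: seg_mem; rewrite (leq_trans mm) ?(leq_trans jn).
Qed.

Lemma seg_nil u m n x : (n <= m)%N -> seg u m n x -> x = 0.
Proof. by move=> nm [a ->]; rewrite big_geq. Qed.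

Lemma seg_recr u m n x : (m <= n)%N -> seg u m n.+1 x ->
  exists a y, x = a *: u n + y /\ seg u m n y.
Proof.
move=> mn [a ->]; exists (a n), (\sum_(m <= j < n) a j *: u j).
by rewrite big_nat_recr //= addrC; split=> //; exists a.
Qed.

Definition tail (P : nat) u := fun i => u (P + i)%N.

Lemma seg_tail P u m n x : seg (tail P u) m n x <-> seg u (P + m) (P + n) x.
Proof.
split; apply: seg_sub => [||j /andP[mj jn]]; try exact: seg0; try exact: segZD.
- by apply: seg_mem; rewrite leq_add2l mj ltn_add2l.
- have Pj : (P <= j)%N by rewrite (leq_trans _ mj) ?leq_addr.
  rewrite -(subnKC Pj) -/(tail P u _); apply: seg_mem.
  by rewrite leq_subRL // mj /= ltn_subLR.
Qed.

Definition step_increasing (p : nat -> nat) := forall i, (p i < p i.+1)%N.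

Lemma step_increasing_le p i j : step_increasing p -> (i <= j)%N -> (p i <= p j)%N.
Proof.
move=> pP; elim: j => [|j IH]; first by rewrite leqn0 => /eqP ->.
by rewrite leq_eqVlt ltnS => /orP[/eqP->//|/IH h]; apply: leq_trans h (ltnW (pP j)).
Qed.

Definition block_seq_at (p : nat -> nat) u w :=
  step_increasing p /\ forall i, seg u (p i) (p i.+1) (w i) /\ w i <> 0.
Definition block_seq u w := exists p, block_seq_at p u w.

Lemma blk_seg p u w m n x : block_seq_at p u w -> seg w m n x -> seg u (p m) (p n) x.
Proof.
move=> [pP wP]; apply: seg_sub => [||j /andP[mj jn]]; [exact: seg0|exact: segZD|].
by have [+ _] := wP j; apply: seg_incl; apply: step_increasing_le.
Qed.

Lemma blk_seg0 p u w n x : block_seq_at p u w -> seg w 0 n x -> seg u 0 (p n) x.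
Proof. by move=> b /(blk_seg b); apply: seg_incl. Qed.

Lemma blk_refl u : (forall i, u i <> 0) -> block_seq u u.
Proof.
move=> u0; exists id; split=> [i|i]; first exact: ltnSn.
by split=> //; apply: seg_mem; rewrite leqnn /=.
Qed.

Lemma blk_at_trans p q u v w : block_seq_at p u v -> block_seq_at q v w ->
  block_seq_at (p \o q) u w.
Proof.
move=> bp [qP wP]; split=> [i|i] /=.
  by case: bp => pP _; apply: leq_trans (pP _) _; apply: step_increasing_le.
by case: (wP i) => /(blk_seg bp) ? ?.
Qed.

Lemma blk_trans u v w : block_seq u v -> block_seq v w -> block_seq u w.
Proof. by move=> [p bp] [q bq]; exists (p \o q); apply: blk_at_trans bp bq. Qed.

(** Linear independence in triangular form, suited to adding one vector at a time. *)
Definition free_upto (n : nat) u := forall m, (m < n)%N -> ~ seg u 0 m (u m).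
Definition free_seq u := forall m, ~ seg u 0 m (u m).

Lemma free_neq0 u i : free_seq u -> u i <> 0.
Proof. by move=> g u0; apply: (g i); rewrite u0; apply: seg0. Qed.

(** If the last coefficient of [x] over the later segment were nonzero, the last vector would lie in
    the span of its predecessors; so the later segment shrinks to nothing. *)
Lemma free_disjoint u m n x : free_seq u -> seg u 0 n x -> seg u n m x -> x = 0.
Proof.
move=> g; elim: m x => [|m IH] x sx; first by apply: seg_nil.
have [nm|mn] := leqP n m; last by apply: seg_nil.
move=> /(seg_recr nm)[a [y [xE sy]]].
have [a0|a0] := eqVneq a 0.
  by apply: IH => //; rewrite xE a0 scale0r add0r.
case: (g m); have -> : u m = a^-1 *: (x - y).
  by rewrite xE addrK scalerA mulVf // scale1r.
by apply/segZ/segB; [apply: seg_incl sx | apply: seg_incl sy].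
Qed.

Lemma free_blk u w : free_seq u -> block_seq u w -> free_seq w.
Proof.
move=> g [p b] m /(blk_seg0 b) h.
by case: (b) => _ /(_ m)[h' []]; apply: free_disjoint g h h'.
Qed.

Lemma free_tail P u : free_seq u -> free_seq (tail P u).
Proof. by move=> g m /seg_tail; rewrite /tail => h; apply: (g (P + m)%N); apply: seg_incl h. Qed.

Lemma blk_of_tail P u w : block_seq (tail P u) w -> block_seq u w.
Proof.
move=> [p [pP wP]]; exists (fun i => P + p i)%N.
by split=> i; [rewrite ltn_add2l|case: (wP i) => /seg_tail].
Qed.

End Norms.
Arguments l1norm {R K} kn {d} a.

(** * Mazur's lemma *)

(** A path of [k] edges of colour [c] with increasing vertices ending at [j]. Only consecutive
    vertices are tested, which is weaker than Ramsey's theorem but enough for a telescoping sum. *)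
Fixpoint cpath (T : Type) (col : nat -> nat -> T) (c : T) (k j : nat) : Prop :=
  if k is k'.+1 then exists i, [/\ (i < j)%N, col i j = c & cpath col c k' i]
  else True.

Lemma pigeonhole (U : finType) (S : nat -> U) : exists i j, (i < j)%N /\ S i = S j.
Proof.
apply: contrapT => H; have [m Um] : exists m, (#|U| < m)%N by exists #|U|.+1.
have Sinj : injective (fun i : 'I_m => S i).
  move=> i j ijE; apply: ord_inj; case: (ltngtP i j) => // ij; case: H.
    by exists i, j.
  by exists j, i.
by have := leq_card _ Sinj; rewrite card_ord leqNgt Um.
Qed.

(* If no monochromatic path had length n, recording for each j the pairs (c, k)
   such that a path of colour c and length k ends at j would embed nat into a
   finite type. *)
Lemma long_cpath (T : finType) (col : nat -> nat -> T) n :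
  exists c j, cpath col c n j.
Proof.
apply: contrapT => H.
have {}H c j : ~ cpath col c n j by move=> h; apply: H; exists c, j.
pose S j : {set T * 'I_n} := [set ck : T * 'I_n | `[<cpath col ck.1 ck.2 j>]]%SET.
have Sneq i j : (i < j)%N -> S i <> S j.
  move=> ij; set c := col i j.
  (* With [k] the length of a longest path of colour [c] ending at [i], the edge from [i] to [j]
     puts [(c, k.+1)] in [S j] but not in [S i]. *)
  have [k [kn pk npk]] : exists k, [/\ (k < n)%N, cpath col c k i & ~ cpath col c k.+1 i].
    apply: contrapT => h; apply: (H c i).
    suff: forall k, (k <= n)%N -> cpath col c k i by apply.
    elim=> // k IH kn; apply: contrapT => npk; apply: h.
    by exists k; split=> //; apply: IH; apply: ltnW.
  have pj : cpath col c k.+1 j by exists i.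
  have kn1 : (k.+1 < n)%N.
    by rewrite ltn_neqAle kn andbT; apply/eqP => kE; apply: (H c j); rewrite -kE.
  move=> /setP/(_ (c, Ordinal kn1)); rewrite !inE => E.
  by apply: npk; apply/asboolP; rewrite E; apply/asboolP.
by have [i [j [ij]]] := pigeonhole S; apply: Sneq.
Qed.

(** * Finite dimensional estimates, Riesz's lemma and Mazur's lemma *)

Section FiniteDim.
Context {R : realType} {K : fieldType} {kn : scalar_abs R K}.
Context {V : lmodType K} (nv : vnorm kn V).
Implicit Types (x y z : V) (u w : nat -> V).

Lemma coef_tb d (r e : R) : 0 < e -> exists (T : finType) (col : ('I_d -> K) -> T),
  forall a b, (forall i, kn (a i) <= r) -> (forall i, kn (b i) <= r) ->
    col a = col b -> forall i, kn (a i - b i) <= e.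
Proof.
move=> /(kn_tb kn r)[T [col colP]].
exists {ffun 'I_d -> T}, (fun a => [ffun i => col (a i)]) => a b ar br /ffunP h i.
by apply: colP => //; have := h i; rewrite !ffunE.
Qed.

(** Were the distance zero, the lower bound [c] would make the coefficients of ever better
    approximations converge, and their limit would represent [x]. *)
Lemma dist_gt0 u n x (c : R) : 0 < c ->
    (forall a, c * \sum_(0 <= i < n) kn (a i) <= nv (\sum_(0 <= i < n) a i *: u i)) ->
    ~ seg u 0 n x ->
  exists2 d : R, 0 < d & forall y, seg u 0 n y -> d <= nv (x - y).
Proof.
move=> c0 low nx; apply: contrapT => H.
(* The factor [c / 4] makes consecutive coefficients differ by at most [2^-1 ^+ t], since two
   approximation errors add up to at most [c * 2^-1 ^+ t]. *)
have near t : exists a : nat -> K,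
    nv (x - \sum_(0 <= i < n) a i *: u i) <= c / 4 * 2^-1 ^+ t.
  apply: contrapT => h; apply: H; exists (c / 4 * 2^-1 ^+ t).
    by rewrite mulr_gt0 ?half_gt0 //; lra.
  move=> y [a ->]; rewrite leNgt; apply/negP => lt; apply: h; exists a; exact: ltW.
have [a aP] := choice near.
have lim i : exists l, (i < n)%N -> forall t, kn (a t i - l) <= 4 * 1 * 2^-1 ^+ t.
  have [li|li] := ltnP i n; last by exists 0.
  have [|l lP] := @kn_complete _ _ kn (a^~ i) 1 ler01; last by exists l.
  move=> t; rewrite mul1r -(ler_pM2l c0).
  apply: (@le_trans _ _ (c * \sum_(0 <= j < n) kn (a t.+1 j - a t j))).
    rewrite ler_pM2l // (big_cat_nat _ (n := i)) ?(ltnW li) //= (big_ltn li).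
    by rewrite addrCA lerDl addr_ge0 // sumr_ge0 // => j _; apply: kn_ge0.
  apply: (le_trans (low _)).
  have -> : \sum_(0 <= j < n) (a t.+1 j - a t j) *: u j =
      (x - \sum_(0 <= j < n) a t j *: u j) - (x - \sum_(0 <= j < n) a t.+1 j *: u j).
    rewrite opprB addrC subrKA -sumrB.
    by apply: eq_bigr => j _; rewrite scalerBl.
  apply: (le_trans (nvB _ _ _)); apply: (le_trans (lerD (aP t) (aP t.+1))).
  rewrite halfS; have := half_gt0 (R := R) t; set h := _ ^+ t => h0; nra.
have [l lP] := choice lim.
apply: nx; exists l; apply/eqP; rewrite -subr_eq0; apply/eqP/(nv0_eq (v := nv)).
apply/le_anti; rewrite nv_ge0 andbT.
apply: (@half_le0 _ (c / 4 + 4 * \sum_(0 <= i < n) nv (u i))) => t.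
apply: (le_trans (nv_tri nv (\sum_(0 <= i < n) a t i *: u i) _ _)).
rewrite mulrDl lerD //; rewrite -sumrB; apply: (le_trans (nv_sum _ _ _ _)).
rewrite mulrAC mulr_sumr !big_nat; apply: ler_sum => i /andP[_ li].
rewrite -scalerBl nvZ ler_wpM2r ?nv_ge0 //.
by apply: le_trans (lP i li t) _; rewrite mulr1.
Qed.

(** Induction together with [dist_gt0]: the distance [d] of [u n] from the earlier span controls the
    last coefficient, and the constant [c] for the earlier vectors controls the others. The three
    terms of [Q] collect these bounds. *)
Lemma seg_lower u n : free_upto n u -> exists2 c : R, 0 < c & forall a : nat -> K,
  c * \sum_(0 <= i < n) kn (a i) <= nv (\sum_(0 <= i < n) a i *: u i).
Proof.
elim: n => [|n IH] g; first by exists 1 => // a; rewrite !big_geq // mulr0 nv0.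
have [|c c0 low] := IH; first by move=> m mn; apply: g; apply: leqW.
have [d d0 dP] := dist_gt0 c0 low (g n (ltnSn n)).
pose Q := d^-1 + c^-1 + nv (u n) / (c * d).
have Q0 : 0 < Q by rewrite ltr_wpDr ?addr_gt0 ?invr_gt0 // divr_ge0 ?nv_ge0 // mulr_ge0 // ltW.
exists Q^-1 => [|a]; first by rewrite invr_gt0.
rewrite mulrC ler_pdivrMr // !big_nat_recr //=.
set s := \sum_(_ <= _ < _) kn _; set y := \sum_(_ <= _ < _) _.
set N := nv _.
have h1 : kn (a n) * d <= N.
  have [->|an] := eqVneq (a n) 0; first by rewrite kn0 mul0r nv_ge0.
  have -> : N = kn (a n) * nv (u n - (- (a n)^-1 *: y)).
    by rewrite -nvZ scalerBr scalerA mulrN divff // scaleN1r opprK addrC.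
  rewrite ler_wpM2l ?kn_ge0 //; apply: dP; apply: segZ; by exists a.
have h2 : c * s <= N + kn (a n) * nv (u n).
  apply: (le_trans (low a)); rewrite -/y -nvZ.
  by have := nvB_ge nv y (- (a n *: u n)); rewrite nvN opprK => h; rewrite -/N in h; lra.
have e1 : kn (a n) <= N * d^-1 by rewrite ler_pdivlMr.
have e2 : s <= N * (c^-1 + nv (u n) / (c * d)).
  rewrite -(ler_pM2l c0) (le_trans h2) //.
  have -> : c * (N * (c^-1 + nv (u n) / (c * d))) = N + N * d^-1 * nv (u n).
    by field; rewrite !gt_eqF.
  by rewrite lerD2l ler_wpM2r ?nv_ge0.
rewrite /Q -addrA mulrDr; lra.
Qed.

Lemma riesz u n : free_upto n.+1 u -> exists x, [/\ seg u 0 n.+1 x, nv x = 1 &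
  forall y, seg u 0 n y -> 1 / 2 <= nv (x - y)].
Proof.
move=> g; have [|c c0 low] := @seg_lower u n; first by move=> m mn; apply: g; apply: leqW.
have [d d0 dP] := dist_gt0 c0 low (g n (ltnSn n)).
pose D := [set r : R | exists2 y, seg u 0 n y & r = nv (u n - y)]%classic.
have D0 : D (nv (u n - 0)) by exists 0 => //; apply: seg0.
have lbD : lbound D d by move=> _ [y sy ->]; apply: dP.
have infD : has_inf D by split; [exists (nv (u n - 0))|exists d].
have dinf : d <= inf D by apply: lb_le_inf => //; exists (nv (u n - 0)).
have inf0 : 0 < inf D by exact: lt_le_trans dinf.
(* The infimum itself serves as tolerance, so [u n - y0] is shorter than twice the distance;
   normalizing then leaves 1/2. *)
have [_ [y0 sy0 ->] lt] := inf_adherent inf0 infD.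
have infle y : seg u 0 n y -> inf D <= nv (u n - y).
  by move=> sy; apply: ge_inf; [case: infD | exists y].
have xn0 : u n - y0 <> 0.
  by move=> h; have := infle _ sy0; rewrite h nv0 leNgt inf0.
have [a a0 na] := nv_normalize nv xn0.
exists (a *: (u n - y0)); split=> // [|y sy].
  by apply/segZ/segB; [apply: seg_mem; rewrite leqnn andbT | apply: seg_incl sy0].
have -> : a *: (u n - y0) - y = a *: (u n - (y0 + a^-1 *: y)).
  by rewrite opprD addrA [RHS]scalerBr scalerA divff // scale1r.
move: na; rewrite !nvZ => na.
have := infle _ (segD sy0 (segZ a^-1 sy)); have := kn_gt0 (kn := kn) a0.
move: (nv (u n - y0)) (nv _) (kn a) (inf D) lt na => N M k I lt na k0 h.
nra.
Qed.

Lemma separated u P : free_seq u -> exists x : nat -> V,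
  [/\ forall n, nv (x n) = 1, forall n, seg u P (P + n.+1) (x n) &
      forall i j, (i < j)%N -> 1 / 2 <= nv (x i - x j)].
Proof.
move=> g; have g' n : free_upto n.+1 (tail P u).
  by move=> m _; apply: free_tail g m.
have [x xP] := choice (fun n => riesz (g' n)).
exists x; split=> [n|n|i j ij]; first by case: (xP n).
  by case: (xP n) => /seg_tail; rewrite addn0.
have [si _ _] := xP i; have [_ _ h] := xP j.
by rewrite nv_sym; apply: h; apply: seg_incl si.
Qed.

(* Mazur's lemma without Hahn-Banach: if every normalized difference of a
   separated sequence (x i) failed, then by total boundedness the failures could
   be made uniform along a long path i_0 < ... < i_k, where the telescoping sum
   of the x i_l - x i_(l+1) is bounded while the sum of k copies of e is not. *)
Lemma mazur (y u : nat -> V) s P (r : R) : free_upto s y -> free_seq u -> 1 < r ->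
  exists q z, [/\ seg u P q z, nv z = 1 & forall e a, seg y 0 s e ->
    nv e <= r * nv (e + a *: z)].
Proof.
move=> gy gu r1; have [x [x1 xu xsep]] := separated P gu.
have [c c0 low] := seg_lower gy.
have r0 : 0 < r by lra.
have ir1 : r^-1 < 1 by rewrite invf_lt1.
have ir0 : 0 < r^-1 by rewrite invr_gt0.
apply: contrapT => H.
(* A failure for the normalized difference of [x i] and [x j], rescaled so that the vector in the
   span of [y] has norm 1 and adding a multiple of [x i - x j] brings it down to [r^-1]. *)
have bad (ij : nat * nat) : exists ba : (nat -> K) * K, (ij.1 < ij.2)%N ->
    nv (\sum_(0 <= k < s) ba.1 k *: y k) = 1 /\
    nv (\sum_(0 <= k < s) ba.1 k *: y k + ba.2 *: (x ij.1 - x ij.2)) <= r^-1.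
  case: ij => i j /=; have [ij|_] := ltnP i j; last by exists (fun=> 0, 0).
  have xij : x i - x j <> 0 by move=> h; have := xsep _ _ ij; rewrite h nv0; lra.
  have [al al0 nal] := nv_normalize nv xij.
  apply: contrapT => h; apply: H; exists (P + j.+1)%N, (al *: (x i - x j)); split=> //.
    apply/segZ/segB => //; apply: seg_incl (xu i) => //.
    by rewrite leq_add2l ltnS ltnW.
  move=> e a [b eE]; rewrite leNgt; apply/negP => lt; apply: h.
  have e0 : e <> 0.
    move=> e0; move: lt.
    by rewrite [X in _ < nv X]e0 nv0 ltNge mulr_ge0 ?nv_ge0 // ltW.
  have [be be0 nbe] := nv_normalize nv e0.
  exists (fun k => be * b k, be * a * al) => _ /=.
  have -> : \sum_(0 <= k < s) (be * b k) *: y k = be *: e.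
    by rewrite eE scaler_sumr; apply: eq_bigr => k _; rewrite scalerA.
  split=> //; rewrite -!scalerA -scalerDr nvZ.
  move: nbe; rewrite nvZ => nbe; have := kn_gt0 (kn := kn) be0.
  move: (kn be) (nv e) (nv _) lt nbe => k N M lt nbe k0.
  rewrite -(ler_pM2l r0) divff ?gt_eqF //; nra.
have [ba baP] := choice bad.
pose e i j := \sum_(0 <= k < s) (ba (i, j)).1 k *: y k.
pose a i j := (ba (i, j)).2.
have e1 i j : (i < j)%N -> nv (e i j) = 1 by move=> /(baP (i, j))[].
have ea i j : (i < j)%N -> nv (e i j + a i j *: (x i - x j)) <= r^-1.
  by move=> /(baP (i, j))[].
(* The multiple of [x i - x j] has norm at most [1 + r^-1 <= 2], while [x i - x j] has norm at least
   1/2. *)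
have a4 i j : (i < j)%N -> kn (a i j) <= 4.
  move=> ij; have := ea i j ij; have := e1 i j ij; have := xsep i j ij => h1 h2 h3.
  have := nvB_ge nv (a i j *: (x i - x j)) (- e i j).
  rewrite opprK nvN h2 nvZ (addrC (a i j *: _)) => h4; have := kn_ge0 kn (a i j); nra.
have b4 i j (k : 'I_s) : (i < j)%N -> kn ((ba (i, j)).1 k) <= c^-1.
  move=> ij; have := low (ba (i, j)).1; rewrite -/(e i j) (e1 _ _ ij) => h.
  rewrite -(ler_pM2l c0) divff ?gt_eqF // (le_trans _ h) // ler_pM2l //.
  by rewrite big_mkord (bigD1 k) //= lerDl sumr_ge0 // => l _; apply: kn_ge0.
(* Exchanging the data of two pairs of equal colour costs at most [d * Q], half of the gap
   [1 - r^-1]; the summand 2 of [Q] bounds the norm of [x i - x j]. A bound [(1 + r^-1) / 2 < 1]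
   survives. *)
pose Q := \sum_(0 <= k < s) nv (y k) + 2.
have Q0 : 0 < Q by rewrite ltr_wpDl // sumr_ge0 // => k _; apply: nv_ge0.
pose d := (1 - r^-1) / 2 / Q.
have d0 : 0 < d by rewrite divr_gt0 //; lra.
have [T1 [col1 col1P]] := coef_tb s c^-1 d0.
have [T2 [col2 col2P]] := kn_tb kn 4 d0.
pose col i j := (col1 (fun k : 'I_s => (ba (i, j)).1 k), col2 (a i j)).
have close i j i' j' : (i < j)%N -> (i' < j')%N -> col i j = col i' j' ->
    nv (e i' j' + a i' j' *: (x i - x j)) <= (1 + r^-1) / 2.
  move=> ij ij' [E1 E2].
  have {E1} d1 (k : 'I_s) : kn ((ba (i', j')).1 k - (ba (i, j)).1 k) <= d.
    by apply: (col1P _ _ _ _ (esym E1)) => l; apply: b4.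
  have {E2} d2 : kn (a i' j' - a i j) <= d by apply: (col2P _ _ _ _ (esym E2)); apply: a4.
  have -> : e i' j' + a i' j' *: (x i - x j) =
      (e i j + a i j *: (x i - x j)) +
      ((e i' j' - e i j) + (a i' j' - a i j) *: (x i - x j)).
    by rewrite scalerBl addrACA !subrKC.
  apply: (le_trans (nvD _ _ _)); have h1 := ea i j ij.
  suff: nv ((e i' j' - e i j) + (a i' j' - a i j) *: (x i - x j)) <= d * Q.
    have -> : d * Q = (1 - r^-1) / 2 by rewrite /d divfK ?gt_eqF.
    lra.
  apply: (le_trans (nvD _ _ _)); rewrite mulrDr lerD //.
    rewrite /e -sumrB (le_trans (nv_sum _ _ _ _)) // mulr_sumr !big_mkord.
    apply: ler_sum => k _; rewrite -scalerBl nvZ ler_wpM2r ?nv_ge0 //.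
  rewrite nvZ ler_pM ?kn_ge0 ?nv_ge0 // (le_trans (nvB _ _ _)) // !x1; lra.
(* The telescoped term has norm at most 8, from a coefficient at most 4 and a difference of unit
   vectors. So [k <= k * ((1 + r^-1) / 2) + 8], which this choice of [k] excludes. *)
have [k k16] : exists k : nat, 16 / (1 - r^-1) < k%:R.
  by eexists; apply: archi_boundP; rewrite divr_ge0 //; lra.
(* The last edge of the path supplies the reference data [E] and [A]; the remaining [k] edges,
   ending at [i], are summed with these same data. *)
have [c1 [j [i [ij cE cp]]]] := long_cpath col k.+1.
pose E := e i j; pose A := a i j.
have step n l : cpath col c1 n l -> exists m,
    nv (n%:R *: E + A *: (x m - x l)) <= n%:R * ((1 + r^-1) / 2).
  elim: n l => [|n IH] l; first by exists l; rewrite subrr !scale0r scaler0 addr0 nv0 mul0r.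
  move=> [l' [ll lE /IH[m hm]]]; exists m.
  have -> : n.+1%:R *: E + A *: (x m - x l) =
      (n%:R *: E + A *: (x m - x l')) + (E + A *: (x l' - x l)).
    rewrite addrACA -scalerDr addrA subrK -{3}(scale1r E) -scalerDl.
    by rewrite -natr1.
  apply: (le_trans (nvD _ _ _)); rewrite -natr1 mulrDl mul1r lerD //.
  by apply: close; rewrite ?cE.
have [m hm] := step _ _ cp.
have E1 : nv (k%:R *: E) = k%:R by rewrite nvZ kn_nat e1 ?mulr1.
have A8 : nv (A *: (x m - x i)) <= 8.
  rewrite nvZ; have := a4 i j ij; have := kn_ge0 kn A; rewrite -/A.
  have := nvB nv (x m) (x i); rewrite !x1; have := nv_ge0 nv (x m - x i).
  by move: (nv _) (kn A) => N M; nra.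
have := nvB_ge nv (k%:R *: E) (- (A *: (x m - x i))); rewrite opprK nvN E1 => h.
move: k16; rewrite ltr_pdivrMr; last by lra.
by move: hm h; move: (nv (_ + _)) => N hm h; lra.
Qed.

End FiniteDim.

(** * Deciding the shapes of tuples *)

(** The colour is the cell of a grid of mesh [d] on the interval from [-r] to [r]. *)
Lemma real_tb (R : realType) (r d : R) : 0 < d -> exists (T : finType) (col : R -> T),
  forall x y, `|x| <= r -> `|y| <= r -> col x = col y -> `|x - y| <= d.
Proof.
move=> d0; pose m := Num.bound (2 * r / d).
exists 'I_m.+1, (fun x => inord (Num.trunc ((x + r) / d))) => x y xr yr.
have bnd z : `|z| <= r -> [/\ 0 <= (z + r) / d,
    (Num.trunc ((z + r) / d) < m.+1)%N &
    (Num.trunc ((z + r) / d))%:R <= (z + r) / d < (Num.trunc ((z + r) / d)).+1%:R].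
  rewrite ler_norml => /andP[z1 z2].
  have z0 : 0 <= (z + r) / d by apply: divr_ge0; [lra|exact: ltW].
  split=> //; last by rewrite trunc_itv.
  rewrite -(ltr_nat R) (@le_lt_trans _ _ ((z + r) / d)) ?truncn_le //.
  have rd : 0 <= 2 * r / d by apply: divr_ge0; [lra|exact: ltW].
  have := archi_boundP rd; rewrite -/m -natr1 => h.
  have : (z + r) / d <= 2 * r / d by rewrite ler_pM2r ?invr_gt0 //; lra.
  by lra.
have [x0 xm /andP[x1 x2]] := bnd x xr; have [y0 ym /andP[y1 y2]] := bnd y yr.
move=> /(congr1 val); rewrite /= !inordK // => E; move: x1 x2 y1 y2; rewrite -E -natr1.
set t := _%:R; rewrite ler_pdivlMr // ltr_pdivrMr // ler_pdivlMr // ltr_pdivrMr //.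
by rewrite ler_norml => ????; apply/andP; split; lra.
Qed.

Section Saturation.
Context {R : realType} {K : fieldType} {kn : scalar_abs R K}.
Context {V : lmodType K} (nv : vnorm kn V).
Implicit Types (x z : V) (u w : nat -> V).

(* k = true: arbitrary vectors of the span of u; k = false: successive blocks. *)
Definition tuple_in (k : bool) d u (v : 'I_d -> V) := exists2 p, step_increasing p &
  forall i : 'I_d, seg u (if k then 0%N else p i) (p i.+1) (v i).

Lemma tuple_in_blk k d u w (v : 'I_d -> V) : block_seq u w -> tuple_in k w v -> tuple_in k u v.
Proof.
move=> [p b] [q qP vP]; exists (p \o q) => [i|i] /=.
  by case: b => pP _; apply: leq_trans (pP _) (step_increasing_le pP (qP i)).
by move: (vP i); case: k {vP} => [/(blk_seg0 b)|/(blk_seg b)].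
Qed.

(* Riesz's lemma gives d normalized vectors with lower bound 4^-d; the remaining
   factor 4 allows for perturbations. *)
Definition adm_cst (d : nat) : R := 4^-1 ^+ d.+1.

Lemma adm_cst_gt0 d : 0 < adm_cst d.
Proof. by rewrite exprn_gt0 // invr_gt0 ltr0n. Qed.

Lemma adm_cst_le d e : (d <= e)%N -> adm_cst e <= adm_cst d.
Proof. by move=> de; apply: ler_wiXn2l; rewrite ?ltnS //; lra. Qed.

(** The upper bound 2 rather than 1 leaves room for perturbing unit vectors; the lower bound later
    makes errors relative. *)
Definition admissible d (v : 'I_d -> V) :=
  (forall i, nv (v i) <= 2) /\ forall a, adm_cst d * l1norm kn a <= nv (lincomb v a).

(** Under the bound 2 the induced norm is 2-Lipschitz for [l1norm], so its rounded values on a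
    finite net of coefficient vectors determine it on the [l1norm] unit sphere, and homogeneity does
    the rest. *)
Lemma shape_tb d (e : R) : 0 < e -> exists (T : finType) (col : ('I_d -> V) -> T),
  forall v w : 'I_d -> V, admissible v -> admissible w -> col v = col w ->
    forall a, `|nv (lincomb v a) - nv (lincomb w a)| <= e * l1norm kn a.
Proof.
move=> e0; have d8 : 0 < 8 * (d.+1%:R : R) by rewrite mulr_gt0 ?ltr0n.
(* This mesh keeps the [l1norm] error below [e / 8], hence the norm error below [e / 4] for each of
   the two tuples; rounding spends the other [e / 2]. The successor keeps the denominator positive
   for [d = 0]. *)
have e1 : 0 < e / (8 * d.+1%:R) by rewrite divr_gt0.
have [T0 [col0 col0P]] := coef_tb (kn := kn) d 1 e1.
have [T1 [col1 col1P]] := real_tb (2 * d%:R) (divr_gt0 e0 (ltr0n R 2)).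
have reps c : exists a : 'I_d -> K, (forall i, kn (a i) <= 1) /\
    ((exists2 b, (forall i, kn (b i) <= 1) & col0 b = c) -> col0 a = c).
  have [[b bP bc]|nb] := pselect (exists2 b, (forall i, kn (b i) <= 1) & col0 b = c).
    by exists b.
  by exists (fun=> 0); split=> // i; rewrite kn0.
have [rep repP] := choice reps.
have l1d (a : 'I_d -> K) t : (forall i, kn (a i) <= t) -> l1norm kn a <= t * d%:R.
  move=> at_; apply: (@le_trans _ _ (\sum_(i < d) t)); first exact: ler_sum.
  by rewrite sumr_const card_ord mulr_natr.
exists {ffun T0 -> T1}, (fun v => [ffun c => col1 (nv (lincomb v (rep c)))]) => v w.
move=> av aw /ffunP E a.
have [L0|L0] := eqVneq (l1norm kn a) 0.
  have a0 i : a i = 0.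
    have: (\sum_i kn (a i) == 0) by apply/eqP.
    rewrite psumr_eq0 => [/allP/(_ i)|j _]; last exact: kn_ge0.
    by rewrite mem_index_enum => /(_ isT)/eqP/kn0_eq.
  have l0 (t : 'I_d -> V) : lincomb t a = 0.
    by apply: big1 => i _; rewrite a0 scale0r.
  by rewrite !l0 subrr normr0 L0 mulr0.
have Lp : 0 < l1norm kn a by rewrite lt_neqAle eq_sym L0 l1norm_ge0.
have [al alE] := @kn_onto _ _ kn (l1norm kn a)^-1 (ltac:(by rewrite invr_ge0 ltW)).
pose b i := al * a i.
have bE (t : 'I_d -> V) : nv (lincomb t a) = l1norm kn a * nv (lincomb t b).
  have -> : lincomb t b = al *: lincomb t a.
    by rewrite scaler_sumr; apply: eq_bigr => i _; rewrite scalerA.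
  by rewrite nvZ alE mulrA divff // mul1r.
have b1 i : kn (b i) <= 1.
  rewrite knM alE mulrC ler_pdivrMr // mul1r /l1norm (bigD1 i) //= lerDl.
  by apply: sumr_ge0 => j _; apply: kn_ge0.
have [r1 rc] := repP (col0 b); set r := rep _ in r1 rc.
have {}rc : col0 r = col0 b by apply: rc; exists b.
have br : l1norm kn (fun i => b i - r i) <= e / (8 * d.+1%:R) * d%:R.
  by apply: l1d; apply: col0P.
have e8 : e / (8 * d.+1%:R) * d%:R <= e / 8.
  rewrite invfM mulrA -mulrA; apply: ler_piMr; first by apply: divr_ge0; lra.
  by rewrite mulrC ler_pdivrMr ?ltr0n // mul1r ler_nat.
have {e8}br := le_trans br e8.
have nb (t : 'I_d -> V) : admissible t -> `|nv (lincomb t b) - nv (lincomb t r)| <= e / 4.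
  move=> [t2 _]; apply: (le_trans (nvB_norm _ _ _)); rewrite lincombBr.
  by apply: (le_trans (lincomb_le _ t2)); lra.
have nr (t : 'I_d -> V) : admissible t -> `|nv (lincomb t r)| <= 2 * d%:R.
  move=> [t2 _]; rewrite ger0_norm ?nv_ge0 // (le_trans (lincomb_le _ t2)) //.
  by rewrite ler_pM2l // (le_trans (l1d _ _ r1)) ?mul1r.
have h : `|nv (lincomb v r) - nv (lincomb w r)| <= e / 2.
  by apply: col1P; [exact: nr|exact: nr|have := E (col0 b); rewrite !ffunE].
rewrite !bE -mulrBr normrM gtr0_norm // mulrC ler_pM2r //.
move: h (nb v av) (nb w aw); rewrite !ler_norml => /andP[? ?] /andP[? ?] /andP[? ?].
by apply/andP; split; lra.
Qed.

(** The colours are treated one at a time: if some block sequence misses the colour, pass to it, and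
    otherwise keep the current one. By heredity a missed colour stays missed, so earlier decisions
    persist. *)
Lemma decide (T : finType) (Q : T -> (nat -> V) -> Prop) u :
    (forall t u w, block_seq u w -> Q t w -> Q t u) -> (forall i, u i <> 0) ->
  exists2 w, block_seq u w & forall t, Q t w -> forall w', block_seq w w' -> Q t w'.
Proof.
move=> Qup u0.
suff H (s : seq T) : exists2 w, block_seq u w &
    forall t, t \in s -> Q t w -> forall w', block_seq w w' -> Q t w'.
  by have [w uw wP] := H (enum T); exists w => // t; apply: wP; rewrite mem_enum.
elim: s => [|t s [w uw wP]]; first by exists u => //; apply: blk_refl.
have [[w1 ww1 nQ]|H] := pselect (exists2 w1, block_seq w w1 & ~ Q t w1).
  exists w1 => [|t']; first exact: blk_trans ww1.
  rewrite inE => /orP[/eqP -> //|ts Q1 w' w1w'].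
  by apply: (wP t') => //; [apply: Qup ww1 Q1 | apply: blk_trans w1w'].
exists w => // t'; rewrite inE => /orP[/eqP -> _ w' ww'|]; last exact: wP.
by apply: contrapT => nQ; apply: H; exists w'.
Qed.

(** What survives of a decided colouring once the colours are forgotten: close copies of each tuple
    in all further block sequences, for both kinds of tuples and all lengths up to [D]. *)
Definition decided (D : nat) (e : R) w := forall k d (v : 'I_d -> V), (d <= D)%N ->
  tuple_in k w v -> admissible v -> forall w', block_seq w w' -> exists v' : 'I_d -> V,
    [/\ tuple_in k w' v', admissible v' &
        forall a, `|nv (lincomb v a) - nv (lincomb v' a)| <= e * l1norm kn a].

Lemma decided_blk D e u w : block_seq u w -> decided D e u -> decided D e w.
Proof.
move=> uw H k d v dD tv av w' ww'.
by apply: H dD (tuple_in_blk uw tv) av _ (blk_trans uw ww').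
Qed.

Lemma ex_decided D (e : R) u : 0 < e -> (forall i, u i <> 0) ->
  exists2 w, block_seq u w & decided D e w.
Proof.
move=> e0 u0; have [T TP] := choice (fun d => shape_tb d e0).
pose col d : ('I_d -> V) -> T d := projT1 (cid (TP d)).
have colP d (v w : 'I_d -> V) : admissible v -> admissible w -> col d v = col d w ->
    forall a, `|nv (lincomb v a) - nv (lincomb w a)| <= e * l1norm kn a.
  exact: (projT2 (cid (TP d))).
(* A colour records the kind of tuple, its length and its shape, so that a single application of
   [decide] treats them all. *)
pose I : finType := (bool * {d : 'I_D.+1 & T d})%type.
pose Q (t : I) u := exists v : 'I_(tag t.2) -> V,
  [/\ tuple_in t.1 u v, admissible v & col _ v = tagged t.2].
have Qup t u' w : block_seq u' w -> Q t w -> Q t u'.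
  by move=> b [v [tv av cv]]; exists v; split=> //; apply: tuple_in_blk tv.
have [w uw wP] := decide Qup u0; exists w => // k d v dD.
rewrite -ltnS in dD; move=> tv av w' ww'.
pose t : I := (k, @Tagged _ (Ordinal dD) (fun d : 'I_D.+1 => T d) (col d v)).
have Qt : Q t w by exists v.
have [v' [tv' av' cv']] := wP t Qt w' ww'.
by exists v'; split=> //; apply: colP => //; rewrite cv'.
Qed.

Lemma seg_eq u w m n x : (forall j, (m <= j < n)%N -> u j = w j) ->
  seg u m n x -> seg w m n x.
Proof.
move=> uw; apply: seg_sub => [||j mjn]; [exact: seg0|exact: segZD|].
by rewrite uw //; apply: seg_mem.
Qed.

(** [y s] uses only the part of [w s] that precedes the first block of [w s.+1]; pulled back to a
    fixed [w s], these parts become consecutive. *)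
Lemma diag_blk (w : nat -> nat -> V) (e : nat -> nat -> nat) (q : nat -> nat) (y : nat -> V) :
    (forall s, block_seq_at (e s) (w s) (w s.+1)) -> (forall s, (q s <= e s 0)%N) ->
    (forall s, seg (w s) 0 (q s) (y s)) -> (forall s, y s <> 0) ->
  forall s, block_seq (w s) (tail s y).
Proof.
move=> eP qe yP y0 s.
have e0 t : (0 < e t 0)%N.
  apply: leq_trans (qe t); rewrite lt0n; apply/eqP => q0.
  by apply: (y0 t); apply: seg_nil (yP t); rewrite q0.
(* [E i] translates positions in [w (s + i)] into positions in [w s]; the diagonal block [i] runs
   from [E i 0] to [E i.+1 0]. *)
pose E := fix E i := if i is i'.+1 then E i' \o e (s + i')%N else id.
have EP i : step_increasing (E i) /\ forall m n x,
    seg (w (s + i)%N) m n x -> seg (w s) (E i m) (E i n) x.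
  elim: i => [|i [IH1 IH2]]; first by split=> [j|]; rewrite ?addn0 //; apply: ltnSn.
  split=> [j|m n x] /=.
    by apply: leq_trans (IH1 _) (step_increasing_le IH1 _); case: (eP (s + i)%N).
  by rewrite addnS => /(blk_seg (eP _)) /IH2.
exists (fun i => E i 0%N); split=> [i|i] /=.
  have [EI _] := EP i.
  by apply: leq_trans (EI 0%N) (step_increasing_le EI (e0 _)).
have [EI Eseg] := EP i; split; last exact: y0.
by have /Eseg := yP (s + i)%N; apply: seg_incl => //; apply: step_increasing_le.
Qed.

(** The basis constant expressed by finite sums, a form that passes to block sequences at once. *)
Definition basis_bound (C : R) u := forall m n x y, seg u 0 m x -> seg u m n y ->
  nv x <= C * nv (x + y).

Lemma basis_bound_blk C u w : block_seq u w -> basis_bound C u -> basis_bound C w.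
Proof.
move=> [p b] H m n x y sx sy.
by apply: H (blk_seg0 b sx) (blk_seg b sy).
Qed.

Lemma saturated (u0 : nat -> V) (eta : R) (D : nat -> nat) (d : nat -> R) :
    free_seq u0 -> 0 < eta -> (forall s, 0 < d s) ->
  exists y : nat -> V, [/\ forall i, nv (y i) = 1, basis_bound (1 + eta) y &
    forall s, decided (D s) (d s) (tail s y)].
Proof.
move=> g0 eta0 d0.
(* Increasing from 1 towards [1 + eta]: the ratio [C n.+1 / C n > 1] is the tolerance given to
   Mazur's lemma at stage [n], and the product of these ratios telescopes below [1 + eta]. *)
pose C n := 1 + eta * (1 - 2^-1 ^+ n).
have C1 n : 1 <= C n.
  have h1 := half_le (R := R) (leq0n n); rewrite expr0 in h1.
  by rewrite lerDl; apply: mulr_ge0; [exact: ltW|lra].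
have CS n : C n < C n.+1.
  by rewrite /C halfS ltrD2l ltr_pM2l //; have := half_gt0 (R := R) n; lra.
have Ceta n : C n <= 1 + eta.
  by rewrite lerD2l; apply: ler_piMr; [exact: ltW|have := half_gt0 (R := R) n; lra].
pose mz n (ys : nat -> V) := forall x a, seg ys 0 n x ->
  C n * nv x <= C n.+1 * nv (x + a *: ys n).
have extend n u (ys : nat -> V) : free_seq u -> free_upto n ys -> exists w z q,
    [/\ block_seq u w, free_seq w, decided (D n) (d n) w & seg w 0 q z /\ nv z = 1 /\
     forall x a, seg ys 0 n x -> C n * nv x <= C n.+1 * nv (x + a *: z)].
  move=> gu gy; have [w uw dw] := ex_decided (D n) (d0 n) (fun i => free_neq0 (i := i) gu).
  have gw := free_blk gu uw.
  have Cn : 0 < C n by have := C1 n; lra.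
  have r1 : 1 < C n.+1 / C n by rewrite ltr_pdivlMr // mul1r.
  have [q [z [sz z1 zP]]] := mazur nv 0 gy gw r1.
  exists w, z, q; split=> //; split=> //; split=> // x a /(zP x a).
  rewrite -(ler_pM2l Cn) (mulrA (C n)).
  by rewrite [C n * (_ / _)]mulrC divfK ?gt_eqF.
(* The state holds the current decided sequence, the vectors chosen so far, and an index beyond the
   support of the newest vector, where the next stage starts. *)
pose inv n (st : (nat -> V) * (nat -> V) * nat) := let: (w, ys, q) := st in
  [/\ free_seq w, decided (D n) (d n) w, seg w 0 q (ys n), nv (ys n) = 1 &
   mz n ys /\ free_upto n.+1 ys].
pose step n (st st' : (nat -> V) * (nat -> V) * nat) :=
  block_seq (tail st.2 st.1.1) st'.1.1 /\ forall i, (i <= n)%N -> st'.1.2 i = st.1.2 i.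
pose upd (ys : nat -> V) n z := fun i => if i == n then z else ys i.
have updE ys n z i : (i < n)%N -> upd ys n z i = ys i.
  by move=> ni; rewrite /upd ltn_eqF.
have mk n w ys z q : free_seq w -> decided (D n) (d n) w -> seg w 0 q z -> nv z = 1 ->
    (forall x a, seg ys 0 n x -> C n * nv x <= C n.+1 * nv (x + a *: z)) ->
    free_upto n ys -> inv n (w, upd ys n z, q).
  move=> gw dw sz z1 zP gy; have E : upd ys n z n = z by rewrite /upd eqxx.
  have sE m x : (m <= n)%N -> seg (upd ys n z) 0 m x -> seg ys 0 m x.
    move=> mn; apply: seg_eq => j /andP[_ jm]; apply: updE; exact: leq_trans jm mn.
  split; rewrite ?E //; split=> [x a /(sE n x (leqnn n))|m mn].
    by rewrite E; apply: zP.
  move: mn; rewrite ltnS leq_eqVlt => /orP[/eqP -> |mn].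
    (* Independence follows from the Mazur estimate: a new unit vector [z] in the old span would
       give [C n <= 0] on subtracting [z] from itself. *)
    rewrite E => /(sE _ _ (leqnn n)) /(zP z (-1)).
    rewrite scaleN1r subrr nv0 z1 mulr0 mulr1; have := C1 n; lra.
  by rewrite updE // => /(sE _ _ (ltnW mn)); apply: gy.
have [w [z [q [_ gw dw [sz [z1 zP]]]]]] := extend 0%N u0 (fun=> 0) g0 (ltac:(by [])).
have i0 := mk 0%N w (fun=> 0) z q gw dw sz z1 zP (ltac:(by [])).
have next n st : inv n st -> exists2 st', inv n.+1 st' & step n st st'.
  case: st => [[wn ys] qn] /= [gwn dwn syn yn1 [mzn gy]].
  have gs : free_seq (tail qn wn) by exact: free_tail.
  have [w' [z' [q' [b' gw' dw' [sz' [z1' zP']]]]]] := extend n.+1 _ ys gs gy.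
  exists (w', upd ys n.+1 z', q'); first exact: mk.
  by split=> // i ni /=; rewrite updE.
have [g gE gP] := dependent_choice_inv i0 next.
pose y n := (g n).1.2 n.
have yE n i : (i <= n)%N -> (g n).1.2 i = y i.
  elim: n => [|n IH]; first by rewrite leqn0 => /eqP ->.
  rewrite leq_eqVlt => /orP[/eqP -> //|]; rewrite ltnS => ni.
  by have [_ [_ ->]] := gP n; rewrite ?IH.
have invg n : [/\ free_seq (g n).1.1, decided (D n) (d n) (g n).1.1,
    seg (g n).1.1 0 (g n).2 (y n), nv (y n) = 1 & mz n (g n).1.2].
  by have [+ _] := gP n; rewrite /inv /y; case: (g n) => -[w' ys] q' [? ? ? ? []].
have y1 n : nv (y n) = 1 by case: (invg n).
have y0 n : y n <> 0 by move=> h; have := y1 n; rewrite h nv0; lra.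
exists y; split=> // [m n x x' sx|s].
  case: (leqP n m) => [nm /(seg_nil nm) ->|mn].
    by rewrite addr0 ler_peMl ?nv_ge0 //; lra.
  suff H : seg y m n x' -> C m * nv x <= C n * nv (x + x').
    move=> /H h; have h1 := C1 m; have h2 := Ceta n.
    have := nv_ge0 nv x; have := nv_ge0 nv (x + x'); nra.
  move: (ltnW mn) => {}mn; rewrite -(subnK mn); elim: (n - m)%N x' => [|k IH] x'.
    by rewrite add0n => /(seg_nil (leqnn m)) ->; rewrite addr0.
  rewrite addSn => /(seg_recr (leq_addl _ _))[a [z' [-> sz']]].
  apply: (le_trans (IH _ sz')); rewrite [a *: _ + _]addrC addrA.
  have [_ _ _ _ mzn] := invg (k + m)%N; rewrite -(yE _ _ (leqnn _)); apply: mzn.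
  apply: (@seg_eq y) => [j /andP[_ jk]|]; first by rewrite yE // ltnW.
  apply: segD; first by apply: seg_incl sx; rewrite ?leq_addl.
  by apply: seg_incl sz'.
have bl n : exists e, block_seq_at e (g n).1.1 (g n.+1).1.1 /\ ((g n).2 <= e 0)%N.
  have [_ [[p [pP wP]] _]] := gP n; exists (fun i => (g n).2 + p i)%N.
  split; last exact: leq_addr.
  by split=> i; [rewrite ltn_add2l | case: (wP i) => /seg_tail].
have [e eP] := choice bl.
have b : block_seq (g s).1.1 (tail s y).
  apply: (@diag_blk (fun n => (g n).1.1) e (fun n => (g n).2)) => // n.
  - by case: (eP n).
  - by case: (eP n).
  - by case: (invg n).
by case: (invg s) => _ dws _ _ _; apply: decided_blk b dws.
Qed.

End Saturation.

(** * Limit shapes *)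

(** The intervals of radius [2 * M * 2^-1 ^+ t] around [u t] are nested; the limit is the supremum
    of their left endpoints. *)
Lemma real_complete (R : realType) (u : nat -> R) (M : R) : 0 <= M ->
    (forall t, `|u t.+1 - u t| <= M * 2^-1 ^+ t) ->
  exists l, forall t, `|u t - l| <= 2 * M * 2^-1 ^+ t.
Proof.
move=> M0 uM.
have stepP t : u t - 2 * M * 2^-1 ^+ t <= u t.+1 - 2 * M * 2^-1 ^+ t.+1 /\
               u t.+1 + 2 * M * 2^-1 ^+ t.+1 <= u t + 2 * M * 2^-1 ^+ t.
  have := uM t; rewrite halfS ler_norml => /andP[h1 h2].
  by move: (2^-1 ^+ t) h1 h2 => h h1 h2; split; lra.
have lo s t : (s <= t)%N -> u s - 2 * M * 2^-1 ^+ s <= u t - 2 * M * 2^-1 ^+ t.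
  elim: t => [|t IH]; first by rewrite leqn0 => /eqP ->.
  rewrite leq_eqVlt => /orP[/eqP -> //|/IH h]; have [h' _] := stepP t; lra.
have hi s t : (s <= t)%N -> u t + 2 * M * 2^-1 ^+ t <= u s + 2 * M * 2^-1 ^+ s.
  elim: t => [|t IH]; first by rewrite leqn0 => /eqP ->.
  rewrite leq_eqVlt => /orP[/eqP -> //|/IH h]; have [_ h'] := stepP t; lra.
have lohi s t : u s - 2 * M * 2^-1 ^+ s <= u t + 2 * M * 2^-1 ^+ t.
  have h := lo s _ (leq_maxl s t); have h' := hi t _ (leq_maxr s t).
  have : 0 <= 2 * M * 2^-1 ^+ maxn s t.
    by rewrite mulr_ge0 ?mulr_ge0 // ltW // half_gt0.
  by lra.
pose S := [set r | exists s, r = u s - 2 * M * 2^-1 ^+ s]%classic.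
have Sub t : ubound S (u t + 2 * M * 2^-1 ^+ t) by move=> _ [s ->].
exists (sup S) => t; rewrite ler_norml.
have h1 : u t - 2 * M * 2^-1 ^+ t <= sup S.
  apply: ub_le_sup; last by exists t.
  by exists (u t + 2 * M * 2^-1 ^+ t).
have h2 : sup S <= u t + 2 * M * 2^-1 ^+ t.
  by apply: ge_sup => //; exists (u t - 2 * M * 2^-1 ^+ t), t.
by apply/andP; split; lra.
Qed.

Lemma half_sum (R : realType) m n : \sum_(m <= j < n) (2^-1 : R) ^+ j <= 2.
Proof.
have [nm|mn] := leqP n m; first by rewrite big_geq.
suff H : \sum_(0 <= j < n) (2^-1 : R) ^+ j = 2 - 2 * 2^-1 ^+ n.
  have h : 0 <= \sum_(0 <= j < m) (2^-1 : R) ^+ j.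
    by apply: sumr_ge0 => j _; apply/ltW/half_gt0.
  move: H; rewrite (big_cat_nat _ (n := m)) ?(ltnW mn) //= => H.
  by have := half_gt0 (R := R) n; lra.
elim: n {mn} => [|n IH]; first by rewrite big_geq // expr0 mulr1 subrr.
by rewrite big_nat_recr //= IH halfS; lra.
Qed.

Section Limits.
Context {R : realType} {K : fieldType} {kn : scalar_abs R K}.
Context {V : lmodType K} (nv : vnorm kn V).
Implicit Types (x z : V) (u w y : nat -> V).

(** A single term is the difference of two consecutive partial sums, each bounded by [C] times the
    norm of the whole. *)
Lemma coef_bound C u m n (b : nat -> K) j : 0 <= C -> basis_bound nv C u -> (m <= j < n)%N ->
  kn (b j) * nv (u j) <= 2 * C * nv (\sum_(m <= i < n) b i *: u i).
Proof.
move=> C0 H /andP[mj jn]; rewrite -nvZ.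
rewrite (big_cat_nat _ (n := j)) ?(ltnW jn) //= (big_ltn jn).
set x1 := \sum_(m <= i < j) _; set x3 := \sum_(_ <= i < n) _.
have s1 : seg u 0 j x1 by apply: (@seg_incl _ _ u m j) => //; exists b.
have s2 : seg u j j.+1 (b j *: u j) by apply/segZ/seg_mem; rewrite leqnn /=.
have s3 : seg u j.+1 n x3 by exists b.
have h1 : nv x1 <= C * nv (x1 + (b j *: u j + x3)).
  apply: (H j n) => //; apply: segD; first by apply: seg_incl s2.
  by apply: seg_incl s3 => //; apply: leqnSn.
have h2 : nv (x1 + b j *: u j) <= C * nv (x1 + (b j *: u j + x3)).
  rewrite addrA; apply: H s3; apply: segD; last by apply: seg_incl s2.
  by apply: seg_incl s1 => //; apply: leqnSn.
have := nvB nv (x1 + b j *: u j) x1; rewrite addrAC subrr add0r => h.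
have -> : nv (b j *: u j) <= 2 * C * nv (x1 + (b j *: u j + x3)) =
  (nv (b j *: u j) <= 2 * (C * nv (x1 + (b j *: u j + x3)))) by rewrite mulrA.
lra.
Qed.

(** Membership in the closed span of the tail from [s], phrased without topology; [closed_spanE]
    makes the link. *)
Definition inspan y s x := forall e : R, 0 < e ->
  exists n z, seg y s n z /\ nv (x - z) <= e.

(** The coefficients of finite approximations of [x] are Cauchy by [coef_bound], and their limits
    are the coordinates of [x]. *)
Lemma coords C y x : 0 <= C -> basis_bound nv C y -> (forall i, nv (y i) = 1) -> inspan y 0 x ->
  exists a : nat -> K, forall e, 0 < e -> exists M, forall m, (M <= m)%N ->
    nv (x - \sum_(0 <= i < m) a i *: y i) <= e.
Proof.
move=> C0 H y1 xY.
have near t : exists nb : nat * (nat -> K), (forall i, (nb.1 <= i)%N -> nb.2 i = 0) /\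
    nv (x - \sum_(0 <= i < nb.1) nb.2 i *: y i) <= 2^-1 ^+ t.
  have [n [z [[b ->] h]]] := xY _ (half_gt0 t).
  exists (n, fun i => if (i < n)%N then b i else 0); split=> [i|] /=.
    by rewrite leqNgt => /negbTE ->.
  by rewrite (eq_big_nat _ _ (F2 := fun i => b i *: y i)) // => i /andP[_ ->].
have [nb nbP] := choice near.
pose n t := (nb t).1; pose b t := (nb t).2.
have b0 t i : (n t <= i)%N -> b t i = 0 by case: (nbP t) => h _; apply: h.
pose S (c : nat -> K) m := \sum_(0 <= i < m) c i *: y i.
have xt t : nv (x - S (b t) (n t)) <= 2^-1 ^+ t by case: (nbP t).
have Sm t m : (n t <= m)%N -> S (b t) m = S (b t) (n t).
  move=> nm; rewrite /S (big_cat_nat _ (n := n t)) //= [X in _ + X](_ : _ = 0) ?addr0 //.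
  by rewrite big_nat big1 // => i /andP[ni _]; rewrite b0 ?scale0r.
have SB c c' m : S c m - S c' m = S (fun i => c i - c' i) m.
  by rewrite -sumrB; apply: eq_bigr => i _; rewrite scalerBl.
have diff t t' M : (n t <= M)%N -> (n t' <= M)%N ->
    nv (S (fun i => b t i - b t' i) M) <= 2^-1 ^+ t + 2^-1 ^+ t'.
  move=> h h'; rewrite -SB !Sm //; apply: (le_trans (nv_tri nv x _ _)).
  by rewrite nv_sym lerD.
have cauchy i t : kn (b t.+1 i - b t i) <= 4 * C * 2^-1 ^+ t.
  pose M := maxn i.+1 (maxn (n t.+1) (n t)).
  have iM : (0 <= i < M)%N by rewrite leq_max ltnSn.
  have := coef_bound (fun i => b t.+1 i - b t i) C0 H iM.
  rewrite y1 mulr1 => h; apply: (le_trans h).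
  have : nv (S (fun i => b t.+1 i - b t i) M) <= 2^-1 ^+ t.+1 + 2^-1 ^+ t.
    by apply: diff; rewrite /M !leq_max leqnn ?orbT.
  rewrite /S halfS; have := half_gt0 (R := R) t; move: (nv _) (_ ^+ t) => N h' h0 hN.
  nra.
have lim i : exists l, forall t, kn (b t i - l) <= 4 * (4 * C) * 2^-1 ^+ t.
  by apply: kn_complete => [|t]; [rewrite mulr_ge0|exact: cauchy].
have [l lP] := choice lim.
(* For fixed [m] the approximations [t'] tend to the limit coefficients. The constant of that
   convergence depends on [m], but it disappears in the limit, so the final bound is uniform in
   [m]. *)
have main t m : (n t <= m)%N -> nv (x - S l m) <= (1 + C) * 2^-1 ^+ t.
  move=> nm; apply: (le_trans (nv_tri nv (S (b t) m) _ _)).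
  rewrite mulrDl mul1r lerD // ?Sm // -(Sm _ _ nm) -subr_le0.
  apply: (@half_le0 _ (C + 16 * C * m%:R)) => t'.
  rewrite lerBlDr; apply: (le_trans (nv_tri nv (S (b t') m) _ _)).
  have h1 : nv (S (b t) m - S (b t') m) <= C * (2^-1 ^+ t + 2^-1 ^+ t').
    pose M := maxn m (maxn (n t) (n t')).
    have hM : nv (S (fun i => b t i - b t' i) M) <= 2^-1 ^+ t + 2^-1 ^+ t'.
      by apply: diff; rewrite /M !leq_max leqnn ?orbT.
    apply: (@le_trans _ _ (C * nv (S (fun i => b t i - b t' i) M))); last exact: ler_wpM2l.
    rewrite SB {2}/S (big_cat_nat _ (n := m)) ?leq_maxl //=.
    by apply: (H m M); eexists.
  have h2 : nv (S (b t') m - S l m) <= 16 * C * m%:R * 2^-1 ^+ t'.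
    rewrite SB; apply: (le_trans (nv_sum _ _ _ _)).
    apply: (@le_trans _ _ (\sum_(0 <= i < m) 4 * (4 * C) * 2^-1 ^+ t')).
      by apply: ler_sum => i _; rewrite nvZ y1 mulr1.
    rewrite sumr_const_nat subn0 -[_ *+ m]mulr_natr; lra.
  by apply: (le_trans (lerD h1 h2)); lra.
exists l => e e0; have [t ht] := @half_small _ (e / (1 + C)) (ltac:(by rewrite divr_gt0 //; lra)).
exists (n t) => m /main /le_trans; apply.
by rewrite -ler_pdivlMl ?[_^-1 * _]mulrC //; lra.
Qed.

(** * Gliding hump and limit norms *)

Lemma seg_lincomb u m n d (v : 'I_d -> V) (a : 'I_d -> K) :
  (forall i, seg u m n (v i)) -> seg u m n (lincomb v a).
Proof.
move=> vP; apply: (big_ind (seg u m n)) => [|x z|i _]; first exact: seg0.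
  exact: segD.
exact: segZ.
Qed.

(** The first [n] coordinates of [n + 1] consecutive vectors of [u] form a matrix with nonzero left
    kernel. A kernel vector gives a combination that starts at [y n] and, once normalized, is cut
    off far out. *)
Lemma approx_block C y u m n (e : R) : 0 <= C -> basis_bound nv C y -> (forall i, nv (y i) = 1) ->
    free_seq u -> (forall i, inspan y 0 (u i)) -> 0 < e ->
  exists m' n' z z', [/\ (m < m')%N, (n < n')%N, seg u m m' z, seg y n n' z' &
    nv z = 1 /\ nv (z - z') <= e].
Proof.
move=> C0 H y1 gu uY e0.
have [a aP] := choice (fun i => coords C0 H y1 (uY i)).
pose A : 'M[K]_(n.+1, n) := \matrix_(j, l) a (m + j)%N l.
have kA : kermx A != 0.
  by rewrite -mxrank_eq0 mxrank_ker -lt0n subn_gt0 ltnS rank_leq_col.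
pose b0 : 'rV[K]_n.+1 := nz_row (kermx A).
have bA : b0 *m A = 0.
  have /submxP[X ->] : (b0 <= kermx A)%MS by apply: nz_row_sub.
  by rewrite -mulmxA mulmx_ker mulmx0.
have b0n : b0 != 0 by rewrite nz_row_eq0.
pose v (j : 'I_n.+1) := u (m + j)%N.
have z0 : lincomb v (b0 0) <> 0.
  move=> z0; have gs : free_upto n.+1 (tail m u) by move=> k _; apply: free_tail.
  have [c c0 cP] := seg_lower nv gs.
  have := cP (fun k => b0 0 (inord k)); rewrite !big_mkord.
  have -> : \sum_(i < n.+1) b0 0 (inord i) *: tail m u i = lincomb v (b0 0).
    by rewrite /lincomb; apply: eq_bigr => i _; rewrite inord_val.
  rewrite z0 nv0 pmulr_rle0 // => h.
  have : \sum_(i < n.+1) kn (b0 0 (inord i)) == 0.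
    by rewrite eq_le h sumr_ge0 // => i _; apply: kn_ge0.
  rewrite psumr_eq0 => [/allP bz|i _]; last exact: kn_ge0.
  case/eqP: b0n; apply/rowP => i; rewrite mxE.
  have := bz i (mem_index_enum _); rewrite inord_val /= => /eqP.
  exact: kn0_eq.
have [al al0 nal] := nv_normalize nv z0.
pose b j := al * b0 0 j.
have zE : al *: lincomb v (b0 0) = lincomb v b.
  by rewrite scaler_sumr; apply: eq_bigr => i _; rewrite scalerA.
(* Each of the vectors of [u] involved is truncated with error [e / B]; adding 1 keeps [B]
   positive. *)
pose B := l1norm kn b + 1.
have B0 : 0 < B by rewrite ltr_wpDl // l1norm_ge0.
have [M MP] := choice (fun i => aP i _ (divr_gt0 e0 B0)).
pose n' := maxn n.+1 (\max_(j < n.+1) M (m + j)%N).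
have nn' : (n <= n')%N by rewrite leq_max leqnSn.
pose c i := \sum_(j < n.+1) b j * a (m + j)%N i.
have c0 i : (i < n)%N -> c i = 0.
  move=> ni; have := congr1 (fun B : 'rV_n => B 0 (Ordinal ni)) bA.
  rewrite !mxE => h; have -> : c i = al * \sum_j b0 0 j * A j (Ordinal ni).
    by rewrite mulr_sumr; apply: eq_bigr => j _; rewrite mxE /b mulrA.
  by rewrite h mulr0.
exists (m + n.+1)%N, n', (lincomb v b), (\sum_(n <= i < n') c i *: y i); split.
- by rewrite addnS ltnS leq_addr.
- by rewrite leq_max ltnSn.
- apply: seg_lincomb => j; apply: seg_mem; rewrite leq_addr ltn_add2l; exact: ltn_ord.
- by exists c.
split; first by rewrite -zE.
have -> : \sum_(n <= i < n') c i *: y i = \sum_(0 <= i < n') c i *: y i.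
  rewrite [RHS](big_cat_nat _ (n := n)) //= [X in X + _](_ : _ = 0) ?add0r //.
  by rewrite big_nat big1 // => i /andP[_ ni]; rewrite c0 ?scale0r.
have -> : \sum_(0 <= i < n') c i *: y i =
    lincomb (fun j : 'I_n.+1 => \sum_(0 <= i < n') a (m + j)%N i *: y i) b.
  rewrite /lincomb (eq_bigr (fun i => \sum_(j < n.+1) (b j * a (m + j)%N i) *: y i)) => [|i _].
    rewrite exchange_big /=; apply: eq_bigr => j _; rewrite scaler_sumr.
    by apply: eq_bigr => i _; rewrite scalerA.
  by rewrite scaler_suml.
rewrite lincombBl; apply: (@le_trans _ _ (e / B * l1norm kn b)).
  apply: lincomb_le => j; apply: MP; rewrite leq_max; apply/orP; right.
  exact: (leq_bigmax j).
by rewrite mulrAC ler_pdivrMr // ler_pM2l // lerDl.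
Qed.

Lemma approx_blk C y u s (th : nat -> R) : 0 <= C -> basis_bound nv C y ->
    (forall i, nv (y i) = 1) -> free_seq u -> (forall i, inspan y 0 (u i)) ->
    (forall j, 0 < th j <= 1 / 2) ->
  exists w w', [/\ block_seq u w, block_seq (tail s y) w' &
    forall j, 1 / 2 <= nv (w' j) /\ nv (w' j - w j) <= th j].
Proof.
move=> C0 H y1 gu uY thP.
pose step j (st st' : nat * nat * V * V) :=
  let: (m, n, _, _) := st in let: (m', n', z, z') := st' in
  [/\ (m < m')%N, (n < n')%N, seg u m m' z, seg y n n' z' & nv z = 1 /\ nv (z - z') <= th j].
(* The state keeps the ends of the last blocks in [u] and [y] and the blocks themselves. Starting at
   [s] in [y] places all blocks [w'] in the tail; the blocks of step [j] are stored in state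
   [j.+1]. *)
have [j [[[m n] z] z'] _|g g0 gP] :=
    @dependent_choice_inv _ (fun _ _ => True) step (0%N, s, 0, 0) I.
  have [|m' [n' [z1 [z1' h]]]] := @approx_block C y u m n (th j) C0 H y1 gu uY.
    by case/andP: (thP j).
  by exists (m', n', z1, z1').
pose M j := (g j).1.1.1; pose N j := (g j).1.1.2.
pose w j := (g j.+1).1.2; pose w' j := (g j.+1).2.
have P j : [/\ (M j < M j.+1)%N, (N j < N j.+1)%N, seg u (M j) (M j.+1) (w j),
    seg y (N j) (N j.+1) (w' j) & nv (w j) = 1 /\ nv (w j - w' j) <= th j].
  have [_] := gP j; rewrite /step /M /N /w /w'.
  by case: (g j) => -[[? ?] ?] ?; case: (g j.+1) => -[[? ?] ?] ?.
have w'h j : 1 / 2 <= nv (w' j).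
  have [_ _ _ _ [w1 h]] := P j; have /andP[_ h'] := thP j.
  by have := nvB_ge nv (w j) (w j - w' j); rewrite opprB subrKC w1; lra.
exists w, w'; split=> [||j]; last first.
  by split=> //; rewrite nv_sym; case: (P j) => _ _ _ _ [].
- have N0 : N 0%N = s by rewrite /N g0.
  have Nincr : step_increasing N by move=> j; case: (P j).
  have Ns j : (s <= N j)%N by rewrite -N0; apply: step_increasing_le.
  exists (fun j => N j - s)%N; split=> [j|j]; first by rewrite ltn_sub2rE.
  have [_ _ _ sw' _] := P j; split; first by apply/seg_tail; rewrite !subnKC.
  by move=> h; have := w'h j; rewrite h nv0; lra.
exists M; split=> [j|j]; first by case: (P j).
have [_ _ sw _ [w1 _]] := P j; split=> // h.
by move: w1; rewrite h nv0; lra.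
Qed.

(* Blocks of y that approximate blocks of u have bounded coefficients on
   vectors of norm at most 2, so tuples transfer_tuples with small error. *)
Lemma transfer_tuples y u s (e : R) : basis_bound nv 2 y -> (forall i, nv (y i) = 1) ->
    free_seq u -> (forall i, inspan y 0 (u i)) -> 0 < e <= 1 ->
  exists2 w', block_seq (tail s y) w' & forall k d (v : 'I_d -> V), tuple_in k w' v ->
    (forall i, nv (v i) <= 2) -> exists2 v' : 'I_d -> V, tuple_in k u v' &
      forall i, nv (v i - v' i) <= e.
Proof.
move=> H y1 gu uY /andP[e0 e1].
(* Coefficients over [w'] are at most [16 = 2 * 2 * 2 / (1/2)], by [coef_bound] for vectors of norm
   at most 2 and blocks of norm at least 1/2. Thus the errors are at most [e / 2 * 2^-1 ^+ j] and
   sum up to at most [e]. *)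
have thP j : 0 < e / 32 * 2^-1 ^+ j <= 1 / 2.
  have h0 := half_gt0 (R := R) j; have h1 := half_le (R := R) (leq0n j).
  rewrite expr0 in h1; apply/andP; split; first by rewrite mulr_gt0 // divr_gt0.
  by move: (_ ^+ j) h0 h1 => h h0 h1; nra.
have [w [w' [uw yw' wP]]] := approx_blk s (ler0n R 2) H y1 gu uY thP.
have Hw' : basis_bound nv 2 w'.
  by apply: basis_bound_blk H; apply: blk_of_tail yw'.
exists w' => // k d v tv v2.
have tr m n x : nv x <= 2 -> seg w' m n x ->
    exists x', seg w m n x' /\ nv (x - x') <= e.
  move=> x2 [b xE]; exists (\sum_(m <= j < n) b j *: w j); split; first by exists b.
  have b16 j : (m <= j < n)%N -> kn (b j) <= 16.
    move=> mjn; have := coef_bound b (ler0n R 2) Hw' mjn; rewrite -xE.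
    have [h _] := wP j; have := kn_ge0 kn (b j).
    by move: (kn _) (nv (w' j)) (nv x) x2 h => A B X x2 h A0; nra.
  rewrite xE -sumrB; apply: (le_trans (nv_sum _ _ _ _)).
  apply: (@le_trans _ _ (\sum_(m <= j < n) (e / 2 * 2^-1 ^+ j))).
    rewrite !big_nat; apply: ler_sum => j mjn; rewrite -scalerBr nvZ.
    have [_ h] := wP j; have := b16 j mjn; have := kn_ge0 kn (b j).
    have := nv_ge0 nv (w' j - w j).
    by move: (kn _) (nv _) (_ ^+ j) h => A B X h; nra.
  by rewrite -mulr_sumr; have := half_sum R m n; move: (\sum_(_ <= _ < _) _) => S; nra.
have [p pP vP] := tv.
have [v' v'P] := choice (fun i : 'I_d => tr _ _ _ (v2 i) (vP i)).
exists v' => [|i]; last by case: (v'P i).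
by apply: tuple_in_blk uw _; exists p => // i; case: (v'P i).
Qed.

Lemma limit_shape y (D : nat -> nat) (dl : nat -> R) s k d (v : 'I_d -> V) :
    basis_bound nv 2 y -> (forall i, nv (y i) = 1) ->
    (forall t, decided nv (D t) (dl t) (tail t y)) ->
    (forall t, (D t <= D t.+1)%N) -> (forall t, dl t.+1 <= dl t / 2) -> 0 <= dl s ->
    (d <= D s)%N -> tuple_in k (tail s y) v -> admissible nv v ->
  exists N : ('I_d -> K) -> R,
    [/\ forall a b, N (fun i => a i + b i) <= N a + N b,
        forall c a, N (fun i => c * a i) = kn c * N a,
        forall a, adm_cst d * l1norm kn a <= N a,
        forall a, `|nv (lincomb v a) - N a| <= 2 * dl s * l1norm kn a &
        forall u, free_seq u -> (forall i, inspan y 0 (u i)) -> forall e, 0 < e ->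
          exists2 v' : 'I_d -> V, tuple_in k u v' &
            forall a, `|nv (lincomb v' a) - N a| <= e * l1norm kn a].
Proof.
move=> H y1 dec Dle dlle dl0 dD tv av.
have y0 i : y i <> 0 by move=> h; have := y1 i; rewrite h nv0; lra.
have dDt t : (d <= D (s + t)%N)%N.
  by elim: t => [|t IH]; rewrite ?addn0 // addnS (leq_trans IH).
have dlt t : dl (s + t)%N <= dl s * 2^-1 ^+ t.
  elim: t => [|t IH]; first by rewrite addn0 expr0 mulr1.
  by rewrite addnS (le_trans (dlle _)) // halfS; lra.
(* Successive copies of the tuple move into later tails, and their norms change by at most
   [dl s * 2^-1 ^+ t] times [l1norm]. *)
pose inv t (v : 'I_d -> V) := tuple_in k (tail (s + t) y) v /\ admissible nv v.
pose step t (v w : 'I_d -> V) := forall a,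
  `|nv (lincomb v a) - nv (lincomb w a)| <= dl (s + t)%N * l1norm kn a.
have i0 : inv 0%N v by split=> //; rewrite addn0.
have next t (w : 'I_d -> V) : inv t w -> exists2 w', inv t.+1 w' & step t w w'.
  move=> [tw aw].
  have b : block_seq (tail (s + t) y) (tail (s + t.+1) y).
    exists S; split=> [j|j]; first exact: ltnSn.
    split; last exact: y0.
    have -> : tail (s + t.+1) y j = tail (s + t) y j.+1 by rewrite /tail addnS addSnnS.
    by apply: seg_mem; rewrite leqnn /=.
  by have [w' [tw' aw' h]] := dec _ _ _ _ (dDt t) tw aw _ b; exists w'.
have [g g0 gP] := dependent_choice_inv i0 next.
have dl_h t : dl s * 2^-1 ^+ t >= 0 by rewrite mulr_ge0 // ltW // half_gt0.
have lim a : exists l, forall t,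
    `|nv (lincomb (g t) a) - l| <= 2 * (dl s * l1norm kn a) * 2^-1 ^+ t.
  apply: real_complete => [|t]; first by rewrite mulr_ge0 // l1norm_ge0.
  have [_ h] := gP t; rewrite distrC (le_trans (h a)) // mulrAC.
  by rewrite ler_wpM2r ?l1norm_ge0.
have [N NP] := choice lim.
have Ng a t : nv (lincomb (g t) a) - 2 * (dl s * l1norm kn a) * 2^-1 ^+ t <= N a /\
              N a <= nv (lincomb (g t) a) + 2 * (dl s * l1norm kn a) * 2^-1 ^+ t.
  by have := NP a t; rewrite ler_norml => /andP[h1 h2]; split; lra.
exists N; split=> [a b|c a|a|a|u gu uY e e0].
- rewrite -subr_le0.
  apply: (@half_le0 _ (2 * dl s * (l1norm kn (fun i => a i + b i) + l1norm kn a + l1norm kn b))) => t.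
  have [_ h] := Ng (fun i => a i + b i) t; have [ha _] := Ng a t; have [hb _] := Ng b t.
  have E : lincomb (g t) (fun i => a i + b i) = lincomb (g t) a + lincomb (g t) b.
    by rewrite /lincomb -big_split; apply: eq_bigr => i _; rewrite scalerDl.
  by have := nvD nv (lincomb (g t) a) (lincomb (g t) b); rewrite -E; lra.
- have E t : nv (lincomb (g t) (fun i => c * a i)) = kn c * nv (lincomb (g t) a).
    by rewrite -nvZ scaler_sumr; congr (nv _); apply: eq_bigr => i _; rewrite scalerA.
  have L : l1norm kn (fun i => c * a i) = kn c * l1norm kn a.
    by rewrite /l1norm mulr_sumr; apply: eq_bigr => i _; rewrite knM.
  have c0 := kn_ge0 kn c.
  apply/le_anti/andP; split; rewrite -subr_le0;
    apply: (@half_le0 _ (4 * dl s * kn c * l1norm kn a)) => t;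
    have := Ng (fun i => c * a i) t; have := Ng a t; rewrite E L;
    move: (N _) (N a) (nv _) (l1norm _ _) (_ ^+ t) => X Y Z l h [h1 h2] [h3 h4]; nra.
- rewrite -subr_le0; apply: (@half_le0 _ (2 * dl s * l1norm kn a)) => t.
  have [h _] := Ng a t; have [[_ [_ h']] _] := gP t; have := h' a; lra.
- by have := NP a 0%N; rewrite g0 expr0 mulr1 mulrA.
(* Error budget: [e / 4] from stage [t] to the limit, [e / 8] for the copy in [w'], [e / 4] for its
   transfer to [u]. Adding 1 to [dl s] covers the case [dl s = 0]. *)
have [t ht] := @half_small _ (e / (8 * (dl s + 1))) (ltac:(by rewrite divr_gt0 ?mulr_gt0 //; lra)).
have {}ht : dl s * 2^-1 ^+ t <= e / 8.
  apply: (@le_trans _ _ ((dl s + 1) * 2^-1 ^+ t)).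
    by rewrite ler_pM2r ?half_gt0 //; lra.
  apply: (@le_trans _ _ ((dl s + 1) * (e / (8 * (dl s + 1))))).
    by rewrite ler_pM2l //; lra.
  by rewrite le_eqVlt; apply/orP; left; apply/eqP; field; rewrite gt_eqF //; lra.
(* At most 1, as [transfer_tuples] requires, and at most [e / 4]. *)
pose e' := e / (e + 4).
have e'P : 0 < e' <= 1.
  by rewrite divr_gt0 ?ler_pdivrMr /=; lra.
have e'e : e' <= e / 4.
  by rewrite ler_pdivrMr ?mulrDr; [have : 0 < e * e by rewrite mulr_gt0|]; lra.
have [w' bw' trans] := transfer_tuples (s + t) H y1 gu uY e'P.
have [[tg ag] _] := gP t.
have [v1 [tv1 [v12 _] cv1]] := dec _ _ _ _ (dDt t) tg ag _ bw'.
have [v2 tv2 cv2] := trans _ _ _ tv1 v12.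
exists v2 => // a; have l0 := l1norm_ge0 (kn := kn) a.
have h1 := NP a t; have h2 := cv1 a.
have h3 : `|nv (lincomb v1 a) - nv (lincomb v2 a)| <= e' * l1norm kn a.
  exact: lincomb_pert cv2.
have h1' : 2 * (dl s * l1norm kn a) * 2^-1 ^+ t <= e / 4 * l1norm kn a.
  have := ler_wpM2r l0 ht; lra.
have h2' : dl (s + t)%N * l1norm kn a <= e / 8 * l1norm kn a.
  by apply: ler_wpM2r => //; apply: le_trans (dlt t) ht.
have h3' : e' * l1norm kn a <= e / 4 * l1norm kn a by apply: ler_wpM2r.
have el : 0 <= e * l1norm kn a by rewrite mulr_ge0 // ltW.
move: h1 h2 h3; rewrite !ler_norml => /andP[? ?] /andP[? ?] /andP[? ?].
by apply/andP; split; lra.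
Qed.

(** Successive Riesz vectors form a basis of the same flag of subspaces whose conditioning depends
    on the dimension alone; this uniformity over all subspaces is what the colourings need. *)
Lemma riesz_basis u k : free_upto k u -> exists x : nat -> V,
  [/\ forall i, (i < k)%N -> seg u 0 i.+1 (x i) /\ nv (x i) = 1,
      forall m z, (m <= k)%N -> seg u 0 m z -> seg x 0 m z &
      forall a : nat -> K, 4^-1 ^+ k * \sum_(0 <= i < k) kn (a i) <=
        nv (\sum_(0 <= i < k) a i *: x i)].
Proof.
move=> g.
have ex i : exists x, (i < k)%N -> [/\ seg u 0 i.+1 x, nv x = 1 &
    forall z, seg u 0 i z -> 1 / 2 <= nv (x - z)].
  have [ik|_] := ltnP i k; last by exists 0.
  have [|x xP] := @riesz _ _ kn _ nv u i; last by exists x.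
  by move=> m mi; apply: g; apply: leq_trans ik.
have [x xP] := choice ex.
have scaled i b z : (i < k)%N -> seg u 0 i z -> kn b / 2 <= nv (z + b *: x i).
  move=> ik sz; have [->|b0] := eqVneq b 0; first by rewrite kn0 mul0r nv_ge0.
  have -> : z + b *: x i = b *: (x i - - (b^-1) *: z).
    by rewrite scalerBr scalerA mulrN divff // scaleN1r opprK addrC.
  have [_ _ h] := xP i ik; rewrite nvZ.
  have := h _ (segZ (- b^-1) sz); have := kn_ge0 kn b.
  by move: (kn _) (nv _) => A B; nra.
exists x; split=> [i ik|m|a].
- by case: (xP i ik).
- elim: m => [|m IH] z mk; first by move=> /(seg_nil (leqnn 0)) ->; apply: seg0.
  have [sx x1 _] := xP m mk.
  have um : seg x 0 m.+1 (u m).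
    have [b [z' [xE sz']]] := seg_recr (leq0n m) sx.
    (* Otherwise [x m] would lie in the earlier span, at distance 0 instead of 1/2. *)
    have b0 : b != 0.
      apply/eqP => b0; have := scaled m 1 (- x m) mk.
      rewrite scale1r addNr nv0 kn1 => h; suff : (1 : R) / 2 <= 0 by lra.
      apply: h; rewrite xE b0 scale0r add0r -scaleN1r; exact: segZ.
    have -> : u m = b^-1 *: (x m - z').
      by rewrite xE addrK scalerA mulVf // scale1r.
    apply/segZ/segB; first by apply: seg_mem; rewrite leq0n /=.
    by apply: seg_incl (IH _ (ltnW mk) sz').
  move=> /(seg_recr (leq0n m))[b [z' [-> sz']]]; apply: segD; first exact: segZ.
  by apply: seg_incl (IH _ (ltnW mk) sz').
(* The last coefficient is at most twice the norm of the sum, so the earlier part is at most three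
   times it. The constant [4 ^+ m - 1] absorbs both in the induction. *)
suff H m : (m <= k)%N -> seg u 0 m (\sum_(0 <= i < m) a i *: x i) /\
    \sum_(0 <= i < m) kn (a i) <= (4 ^+ m - 1) * nv (\sum_(0 <= i < m) a i *: x i).
  have [_ h] := H k (leqnn k); rewrite exprVn mulrC ler_pdivrMr ?exprn_gt0 //.
  by apply: (le_trans h); rewrite mulrC ler_wpM2l ?nv_ge0 // lerBlDr lerDl.
elim: m => [|m IH] mk; first by rewrite !big_geq // subrr mul0r; split=> //; apply: seg0.
have [s1 h] := IH (ltnW mk); rewrite !big_nat_recr //=.
have [sx x1 _] := xP m mk; split.
  by apply: segD; [apply: seg_incl s1 | apply: segZ].
have h1 := scaled m (a m) _ mk s1; move: h h1 {s1}.
set S := \sum_(0 <= i < m) _ *: _; set L := \sum_(0 <= i < m) _ => h h1.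
have := nvB_ge nv S (- (a m *: x m)); rewrite opprK nvN nvZ x1 mulr1 exprSr => h2.
have p1 : 1 <= (4 : R) ^+ m by apply: exprn_ege1; lra.
have P1 : 0 <= (4 : R) ^+ m - 1 by lra.
have := ler_wpM2l P1 h2; move: h h1 h2 p1 {P1}.
move: (kn_ge0 kn (a m)); move: (4 ^+ m) (nv S) (nv (S + _)) L (kn (a m)).
move=> P A B L' c c0 h h1 h2 p1 h3.
have P0 : 0 <= P by lra.
have h4 : P * c <= P * (2 * B) by apply: ler_wpM2l => //; lra.
have h5 : 0 <= P * B by apply: mulr_ge0 => //; lra.
lra.
Qed.

Lemma adm_cst_mul4 d : (adm_cst d : R) * (4 * d%:R) <= 1.
Proof.
rewrite /adm_cst exprS mulrACA mulVf ?pnatr_eq0 // mul1r mulrC.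
rewrite exprVn ler_pdivrMr ?exprn_gt0 // mul1r -natrX ler_nat.
by apply: ltnW; apply: ltn_expl.
Qed.

(** With basis constant 2 each coefficient is at most 4 times the norm, so [l1norm] is at most
    [4 * d] times it, and [adm_cst d] is small enough to compensate. *)
Lemma admissible_blk u w d (v : 'I_d -> V) : basis_bound nv 2 u -> block_seq u w ->
  (forall i : 'I_d, v i = w i /\ nv (v i) = 1) -> admissible nv v.
Proof.
move=> H uw vw; split=> [i|a]; first by case: (vw i) => _ ->; lra.
have Hw := basis_bound_blk uw H.
have ai (i : 'I_d) : kn (a i) <= 4 * nv (lincomb v a).
  pose b j := if insub j is Some i then a i else 0.
  have bE (j : 'I_d) : b j = a j by rewrite /b valK.
  have := @coef_bound 2 w 0 d b i (ler0n R 2) Hw.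
  rewrite ltn_ord => /(_ isT); rewrite bE big_mkord.
  have [vi v1] := vw i; rewrite -vi v1 mulr1.
  have -> : \sum_(i < d) b i *: w i = lincomb v a.
    by rewrite /lincomb; apply: eq_bigr => j _; rewrite bE; case: (vw j) => ->.
  by lra.
have : l1norm kn a <= (4 * d%:R) * nv (lincomb v a).
  rewrite -mulrA mulrCA -[d in d%:R]card_ord mulr_natl -sumr_const.
  exact: ler_sum.
have := adm_cst_mul4 d; have := adm_cst_gt0 (R := R) d; have := nv_ge0 nv (lincomb v a).
move: (adm_cst d : R) (l1norm _ _) (nv _) (4 * _) => c l X n X0 c0 cn lX.
by apply: (@le_trans _ _ (c * (n * X))); [rewrite ler_pM2l | rewrite mulrA ler_piMl].
Qed.

End Limits.

(** * Banach spaces over real and complex scalars *)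

(* The norms of a numFieldType K are elements of K; iota embeds the reals into K
   and recovers them from their real values. *)
Record scalars (R : realType) (K : numFieldType) := Scalars {
  skn :> scalar_abs R K;
  iota : {rmorphism R -> K};
  iota_le : {mono iota : x y / x <= y};
  norm_iota : forall x : K, `|x| = iota (skn x) }.

Lemma scalars_of_modulus (R : realType) (K : numFieldType) (i : {rmorphism R -> K})
    (k : K -> R) : {mono i : x y / x <= y} -> (forall x, `|x| = i (k x)) ->
    (forall (u : nat -> K) (M : R), 0 <= M ->
      (forall t, k (u t.+1 - u t) <= M * 2^-1 ^+ t) ->
      exists l, forall t, k (u t - l) <= 4 * M * 2^-1 ^+ t) ->
    (forall r d : R, 0 < d -> exists (T : finType) (col : K -> T),
      forall x y, k x <= r -> k y <= r -> col x = col y -> k (x - y) <= d) ->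
  inhabited (scalars R K).
Proof.
move=> ile kE compl tb; have iinj : injective i by apply: inc_inj.
have k_ge0 a : 0 <= k a by rewrite -ile rmorph0 -kE.
have k_0 : k 0 = 0 by apply: iinj; rewrite -kE normr0 rmorph0.
have k_nat n : k n%:R = n%:R by apply: iinj; rewrite -kE normr_nat rmorph_nat.
have k_eq0 a : k a = 0 -> a = 0.
  by move=> h; apply/eqP; rewrite -normr_eq0 kE h rmorph0.
have k_M a b : k (a * b) = k a * k b by apply: iinj; rewrite rmorphM -!kE normrM.
have k_D a b : k (a + b) <= k a + k b by rewrite -ile rmorphD -!kE ler_normD.
have k_onto r : 0 <= r -> exists a, k a = r.
  move=> r0; exists (i r); apply: iinj; rewrite -kE ger0_norm //.
  by rewrite -(rmorph0 i) ile.
pose S := ScalarAbs k_ge0 k_0 k_nat k_eq0 k_M k_D k_onto compl tb.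
by constructor; exact: (@Scalars R K S i ile kE).
Qed.

Lemma real_scalars (R : realType) : inhabited (scalars R R).
Proof.
apply: (@scalars_of_modulus R R idfun (fun x => `|x|)) => // [u M M0 uM|r d d0].
  have [l lP] := real_complete M0 uM; exists l => t; apply: (le_trans (lP t)).
  by rewrite ler_pM2r ?half_gt0 // ler_wpM2r // ler_nat.
exact: real_tb.
Qed.

Lemma complex_scalars (R : realType) : inhabited (scalars R R[i]).
Proof.
pose k (z : R[i]) : R := Num.sqrt (complex.Re z ^+ 2 + complex.Im z ^+ 2).
have kRe z : `|complex.Re z| <= k z.
  by rewrite -sqrtr_sqr ler_wsqrtr // lerDl sqr_ge0.
have kIm z : `|complex.Im z| <= k z.
  by rewrite -sqrtr_sqr ler_wsqrtr // lerDr sqr_ge0.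
have kRI z : k z <= `|complex.Re z| + `|complex.Im z|.
  rewrite -[leRHS]ger0_norm ?addr_ge0 // -sqrtr_sqr ler_wsqrtr //.
  rewrite -[complex.Re z ^+ 2]real_normK ?num_real // -[complex.Im z ^+ 2]real_normK ?num_real //.
  have := normr_ge0 (complex.Re z); have := normr_ge0 (complex.Im z); nra.
have ReB (x y : R[i]) : complex.Re (x - y) = complex.Re x - complex.Re y by case: x; case: y.
have ImB (x y : R[i]) : complex.Im (x - y) = complex.Im x - complex.Im y by case: x; case: y.
apply: (@scalars_of_modulus R R[i] (real_complex R) k) => [x y|z|u M M0 uM|r d d0].
- by rewrite lecR.
- by rewrite normc_def.
- have [t|a aP] := @real_complete R (fun t => complex.Re (u t)) M M0.
    by rewrite -ReB (le_trans (kRe _)).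
  have [t|b bP] := @real_complete R (fun t => complex.Im (u t)) M M0.
    by rewrite -ImB (le_trans (kIm _)).
  exists (a +i* b)%C => t; apply: (le_trans (kRI _)); rewrite ReB ImB /=.
  by have := aP t; have := bP t; lra.
have d2 : 0 < d / 2 by rewrite divr_gt0.
have [T [col colP]] := real_tb r d2.
exists (T * T)%type, (fun z => (col (complex.Re z), col (complex.Im z))) => x y xr yr [E1 E2].
apply: (le_trans (kRI _)); rewrite ReB ImB.
have h1 := colP _ _ (le_trans (kRe x) xr) (le_trans (kRe y) yr) E1.
have h2 := colP _ _ (le_trans (kIm x) xr) (le_trans (kIm y) yr) E2.
by lra.
Qed.

(** The two comparisons with [l1norm] give definiteness and completeness of the normed space built
    from [fn]. *)
Record fdnorm (R : realType) (K : fieldType) (kn : scalar_abs R K) (d : nat) := FdNorm {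
  fn :> ('I_d -> K) -> R;
  fnD : forall a b, fn (fun i => a i + b i) <= fn a + fn b;
  fnZ : forall c a, fn (fun i => c * a i) = kn c * fn a;
  fn_lo : exists2 c : R, 0 < c & forall a, c * l1norm kn a <= fn a;
  fn_up : exists L : R, forall a, fn a <= L * l1norm kn a }.

Section Bridge.
Context {R : realType} {K : numFieldType} (S : scalars R K).

Lemma iota_lt : {mono iota S : x y / x < y}.
Proof. exact: leW_mono (@iota_le _ _ S). Qed.

Lemma iota_inj : injective (iota S).
Proof. exact: inc_inj (@iota_le _ _ S). Qed.

Lemma iota_gt0 r : (0 < iota S r) = (0 < r).
Proof. by rewrite -(rmorph0 (iota S)) iota_lt. Qed.

Lemma iota_ge0 r : (0 <= iota S r) = (0 <= r).
Proof. by rewrite -(rmorph0 (iota S)) iota_le. Qed.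

Lemma skn_pos (e : K) : 0 <= e -> iota S (S e) = e.
Proof. by move=> e0; rewrite -(norm_iota S) ger0_norm. Qed.

Lemma skn_gt0 (e : K) : 0 < e -> 0 < S e.
Proof. by move=> e0; rewrite -iota_gt0 skn_pos // ltW. Qed.

Lemma norm_nvE (V : normedModType K) (x : V) : `|x| = iota S (S `|x|).
Proof. by rewrite skn_pos. Qed.

Section Norm.
Context {V : normedModType K}.

Let nvD (x y : V) : S `|x + y| <= S `|x| + S `|y|.
Proof. by rewrite -(iota_le S) rmorphD -!norm_nvE ler_normD. Qed.

Let nvZ a (x : V) : S `|a *: x| = S a * S `|x|.
Proof. by apply: iota_inj; rewrite rmorphM -!norm_nvE normrZ (norm_iota S). Qed.

Let nv0_eq (x : V) : S `|x| = 0 -> x = 0.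
Proof. by move=> h; apply/eqP; rewrite -normr_eq0 norm_nvE h rmorph0. Qed.

(** The norm is packed with its specification and closed by [Qed], so that [nvS] does not unfold. *)
Lemma nvS_key : {n : vnorm S V | forall x, `|x| = iota S (n x)}.
Proof. by exists (VNorm nvD nvZ nv0_eq) => x; apply: norm_nvE. Qed.

Definition nvS : vnorm S V := projT1 nvS_key.

Lemma norm_iotaE (x : V) : `|x| = iota S (nvS x).
Proof. exact: (projT2 nvS_key). Qed.

Lemma cvg_nvS (u : nat -> V) x : u @ \oo --> x <->
  forall e : R, 0 < e -> exists M, forall m, (M <= m)%N -> nvS (x - u m) <= e.
Proof.
split=> [/cvgrPdist_le ux e e0|H].
  have ie : 0 < iota S e by rewrite iota_gt0.
  have [M _ MP] := ux _ ie; exists M => m Mm.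
  by rewrite -(iota_le S) -norm_iotaE; apply: MP.
apply/cvgrPdist_le => e e0; have [M MP] := H _ (skn_gt0 e0).
exists M => // m /= /MP; rewrite -(iota_le S) -norm_iotaE skn_pos //; exact: ltW.
Qed.

Lemma closure_nvS (A : set V) x : closure A x <->
  forall e : R, 0 < e -> exists z, A z /\ nvS (x - z) <= e.
Proof.
split=> [cl e e0|H B /nbhs_ballP[e /= e0 eB]].
  have ie : 0 < iota S e by rewrite iota_gt0.
  have [z [Az]] := cl _ (nbhsx_ballx x _ ie); rewrite -ball_normE /= => xz.
  by exists z; split=> //; rewrite -(iota_le S) -norm_iotaE ltW.
have e2 : 0 < S e / 2 by rewrite divr_gt0 ?skn_gt0.
have [z [Az xz]] := H _ e2; exists z; split=> //; apply: eB.
rewrite -ball_normE /= norm_iotaE -[ltRHS]skn_pos ?ltW // iota_lt.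
by have := skn_gt0 e0; lra.
Qed.

(** Centres of balls of radius [2^-1 ^+ t / 2] belonging to a Cauchy filter form a geometric
    sequence, since any two such balls meet; its limit is the limit of the filter. *)
Lemma geometric_complete : (forall u : nat -> V,
      (forall t, nvS (u t.+1 - u t) <= 2^-1 ^+ t) -> exists l, forall e : R, 0 < e ->
        exists t, forall s, (t <= s)%N -> nvS (u s - l) <= e) ->
  forall F : set_system V, ProperFilter F -> cauchy F -> cvg F.
Proof.
move=> compl F FF /cauchyP cF.
have h0 t : 0 < iota S ((2^-1 : R) ^+ t / 2).
  by rewrite iota_gt0 divr_gt0 // half_gt0.
have [u uP] := choice (fun t => cF _ (h0 t)).
have inball t z : ball (u t) (iota S (2^-1 ^+ t / 2)) z -> nvS (u t - z) <= 2^-1 ^+ t / 2.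
  by rewrite -ball_normE /= norm_iotaE iota_lt => /ltW.
have [t|l lP] := compl u.
  have [z [/inball z1 /inball z2]] := filter_ex (filterI (uP t) (uP t.+1)).
  apply: (le_trans (nv_tri nvS z _ _)); rewrite (nv_sym _ z).
  by move: z2; rewrite halfS; have := half_gt0 (R := R) t; lra.
apply/cvg_ex; exists l; apply/cvgrPdist_le => e e0.
have e2 : 0 < S e / 2 by rewrite divr_gt0 ?skn_gt0.
have [t1 t1P] := half_small e2; have [t2 t2P] := lP _ e2.
pose t := maxn t1 t2; apply: filterS (uP t) => z /inball uz.
rewrite norm_iotaE -[leRHS](skn_pos (ltW e0)) iota_le.
apply: (le_trans (nv_tri nvS (u t) _ _)); rewrite (nv_sym _ l).
have := t2P t (leq_maxr _ _); have := half_le (R := R) (leq_maxl t1 t2); rewrite -/t.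
by have := half_gt0 (R := R) t; lra.
Qed.

End Norm.

(** An alias that mentions [N], so that each norm on row vectors determines its own normed module
    instance. *)
Definition fdspace d (N : fdnorm S d) := 'rV[K]_d.

Section FdSpace.
Context {d : nat} (N : fdnorm S d).

HB.instance Definition _ := GRing.Lmodule.on (fdspace N).

Definition fdspace_norm (x : fdspace N) : K := iota S (N (x 0)).

Let normD x y : fdspace_norm (x + y) <= fdspace_norm x + fdspace_norm y.
Proof.
rewrite -rmorphD iota_le (le_trans _ (fnD N _ _)) //.
by rewrite le_eqVlt; apply/orP; left; apply/eqP; congr (N _); apply/funext => i; rewrite mxE.
Qed.

Let normZ a x : fdspace_norm (a *: x) = `|a| * fdspace_norm x.
Proof.
rewrite (norm_iota S) -rmorphM -fnZ; congr (iota S (N _)).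
by apply/funext => i; rewrite mxE.
Qed.

Let norm0_eq x : fdspace_norm x = 0 -> x = 0.
Proof.
rewrite -[RHS](rmorph0 (iota S)) => /iota_inj h; have [c c0 cP] := fn_lo N.
have := cP (x 0); rewrite h pmulr_rle0 // => l0.
have : l1norm S (x 0) == 0 by rewrite eq_le l0 l1norm_ge0.
rewrite psumr_eq0 => [/allP z|i _]; last exact: kn_ge0.
apply/rowP => i; rewrite mxE; apply: (kn0_eq (s := S)); apply/eqP.
by apply: z; rewrite mem_index_enum.
Qed.

HB.instance Definition _ := Lmodule_isNormed.Build K (fdspace N) normD normZ norm0_eq.

Lemma fdspace_nvE (x : fdspace N) : nvS x = N (x 0).
Proof.
have [c c0 cP] := fn_lo N.
apply: iota_inj; rewrite -norm_iotaE //.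
Qed.

(** The lower bound for [N] makes each coordinate a geometric sequence; the upper bound turns
    coordinatewise convergence into convergence in [N]. *)
Let complete (F : set_system (fdspace N)) : ProperFilter F -> cauchy F -> cvg F.
Proof.
apply: geometric_complete => u uP; have [c c0 cP] := fn_lo N; have [L LP] := fn_up N.
have ci : 0 <= c^-1 by rewrite invr_ge0 ltW.
have le1 (a : 'I_d -> K) i : S (a i) <= l1norm S a.
  by rewrite /l1norm (bigD1 i) //= lerDl sumr_ge0 // => j _; apply: kn_ge0.
have lim i : exists l, forall t, S (u t 0 i - l) <= 4 * c^-1 * 2^-1 ^+ t.
  apply: (kn_complete ci) => t.
  rewrite ler_pdivlMl // (le_trans _ (uP t)) // fdspace_nvE (le_trans _ (cP _)) //.
  rewrite ler_pM2l // (le_trans _ (le1 _ i)) // !mxE //.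
have [l lP] := choice lim.
exists (\row_i l i) => e e0.
pose M := `|L| * d%:R * (4 * c^-1) + 1.
have M0 : 0 < M by rewrite ltr_wpDl // !mulr_ge0.
have [t tP] := half_small (divr_gt0 e0 M0); exists t => s ts.
rewrite fdspace_nvE (le_trans (LP _)) //.
have h : l1norm S ((u s - \row_i l i) 0) <= d%:R * (4 * c^-1) * 2^-1 ^+ s.
  rewrite -mulrA -[d in d%:R]card_ord mulr_natl -sumr_const.
  by apply: ler_sum => i _; rewrite !mxE; apply: lP.
have hs := le_trans (half_le (R := R) ts) tP.
have := half_gt0 (R := R) s; have l0 := l1norm_ge0 (kn := S) ((u s - \row_i l i) 0).
move: hs h l0; set X := l1norm _ _; move=> hs h l0 hp.
apply: (@le_trans _ _ (`|L| * X)); first by rewrite ler_wpM2r ?ler_norm.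
apply: (@le_trans _ _ (`|L| * (d%:R * (4 * c^-1) * 2^-1 ^+ s))); first by rewrite ler_wpM2l.
apply: (@le_trans _ _ (M * 2^-1 ^+ s)); first by rewrite /M; lra.
by rewrite -ler_pdivlMl ?[_^-1 * _]mulrC.
Qed.

HB.instance Definition _ := Uniform_isComplete.Build (fdspace N) complete.

Definition fdspace_banach : completeNormedModType K := fdspace N.

End FdSpace.
End Bridge.

(** * Finite dimensional and closed subspaces *)

Section Assembly.
Context {R : realType} {K : numFieldType} (S : scalars R K).

(** [supremum] is a least upper bound if one exists and 0 otherwise; both values satisfy the bounds,
    and [T 0] shows that a least upper bound is nonnegative. *)
Lemma opnorm_le (V W : normedModType K) (E : set V) (T : V -> W) (M : R) :
    0 <= M -> E 0 -> (forall x, E x -> nvS S (T x) <= M * nvS S x) ->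
  [/\ bounded_on E T, 0 <= opnorm E T & opnorm E T <= iota S M].
Proof.
move=> M0 E0 TM.
have ub : ubound (unit_ball_norms E T) (iota S M).
  move=> _ [x [Ex x1] <-]; rewrite (norm_iotaE S) iota_le (le_trans (TM x Ex)) //.
  by rewrite ler_piMr // -(iota_le S) -norm_iotaE rmorph1.
have bd : bounded_on E T by exists (iota S M).
have T0 : unit_ball_norms E T `|T 0| by exists 0 => //; split; rewrite ?normr0.
split=> //; rewrite /opnorm /supremum; case: ifP => _ //; rewrite ?iota_ge0 //.
  by case: xgetP => // y _ [ubS _]; apply: le_trans (ubS _ T0).
by case: xgetP => [y _ [_ /(_ _ ub)]//|_]; rewrite iota_ge0.
Qed.

Lemma isomorphic_sym (V W : normedModType K) (C : K) (E : set V) (F : set W) :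
  linear_subset E -> isomorphic C E F -> isomorphic C F E.
Proof.
move=> [_ Elin] [T [T' [Tlin TT' T'T [bT bT'] op]]]; exists T', T; split=> //.
- move=> a u v Fu Fv; have [Eu uE] := T'T u Fu; have [Ev vE] := T'T v Fv.
  rewrite -{1}uE -{1}vE -Tlin //.
  by have [_ ->] := TT' _ (Elin a _ _ Eu Ev).
- by rewrite mulrC.
Qed.

Definition lincomb_span (V : lmodType K) d (v : 'I_d -> V) : set V :=
  [set x | exists a, x = lincomb v a].

Definition ext_ord (V : lmodType K) d (v : 'I_d -> V) (i : nat) : V :=
  if insub i is Some j then v j else 0.

Lemma ext_ordE (V : lmodType K) d (v : 'I_d -> V) (i : 'I_d) : ext_ord v i = v i.
Proof. by rewrite /ext_ord valK. Qed.

Lemma lincomb_spanP (V : lmodType K) d (v : 'I_d -> V) x :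
  lincomb_span v x <-> seg (ext_ord v) 0 d x.
Proof.
split=> [[a ->]|[a ->]].
  apply: seg_lincomb => i; rewrite -ext_ordE; apply: seg_mem; exact: ltn_ord.
exists (fun i => a i); rewrite big_mkord /lincomb; apply: eq_bigr => i _; by rewrite ext_ordE.
Qed.

Lemma seg_ord (V : lmodType K) (u : nat -> V) d x :
  seg u 0 d x <-> exists a : 'I_d -> K, x = lincomb (fun i : 'I_d => u i) a.
Proof.
split=> [[a ->]|[a ->]]; first by exists (fun i => a i); rewrite big_mkord.
by apply: seg_lincomb => i; apply: seg_mem; exact: ltn_ord.
Qed.

(** By [dist_gt0] a point outside the span has positive distance from it. *)
Lemma lincomb_span_closed (V : normedModType K) d (v : 'I_d -> V) (c : R) : 0 < c ->
  (forall a, c * l1norm S a <= nvS S (lincomb v a)) -> closed_subspace (lincomb_span v).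
Proof.
move=> c0 low; split; first split.
- by apply/lincomb_spanP; apply: seg0.
- by move=> a x y /lincomb_spanP sx /lincomb_spanP sy; apply/lincomb_spanP; apply: segZD.
move=> x clx; apply: contrapT => /lincomb_spanP nx.
have [|r r0 rP] := dist_gt0 (nv := nvS S) c0 _ nx.
  move=> a; rewrite !big_mkord; have := low (fun i : 'I_d => a i).
  by rewrite /lincomb (eq_bigr (fun i : 'I_d => a i *: ext_ord v i)) // => i _; rewrite ext_ordE.
have r2 : 0 < r / 2 by rewrite divr_gt0.
have [z [/lincomb_spanP /rP h1 h2]] := (closure_nvS S _ _).1 clx _ r2.
by lra.
Qed.

(* Chosen so that (1 + slack e) / (1 - slack e) <= 1 + e. *)
Definition slack (e : R) : R := e / (4 * (1 + e)).

Lemma slack_gt0 e : 0 < e -> 0 < slack e.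
Proof. by move=> e0; rewrite divr_gt0 // mulr_gt0 //; lra. Qed.

Lemma slackE e : 0 < e -> 4 * slack e + 4 * slack e * e = e.
Proof. by move=> e0; rewrite /slack; field; rewrite gt_eqF //; lra. Qed.

(** Here additive errors become multiplicative: [t * l1norm S a] is at most [slack e * N a] because
    [N] dominates [c] times [l1norm]. *)
Lemma equivalent_of_close (d : nat) (N M : ('I_d -> K) -> R) (c e t : R) : 0 < c -> 0 < e ->
    t <= slack e * c -> (forall a, c * l1norm S a <= N a) ->
    (forall a, `|M a - N a| <= t * l1norm S a) ->
  exists A B : R, [/\ 0 < A, 0 < B, A * B <= 1 + e &
    forall a, A^-1 * N a <= M a /\ M a <= B * N a].
Proof.
move=> c0 e0 te cN MN; have s0 := slack_gt0 e0; have sE := slackE e0.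
set q := slack e in te s0 sE.
have q1 : 4 * q < 1 by nra.
exists (1 - q)^-1, (1 + q); split=> [|||a].
- by rewrite invr_gt0; lra.
- by lra.
- by rewrite ler_pdivrMl; [nra|lra].
rewrite invrK; have := MN a; rewrite ler_norml => /andP[h1 h2].
have l0 := l1norm_ge0 (kn := S) a.
have h3 : t * l1norm S a <= q * N a.
  apply: (@le_trans _ _ (q * c * l1norm S a)); first exact: ler_wpM2r.
  by rewrite -mulrA ler_pM2l.
by split; lra.
Qed.

Lemma fdspace_iso d (N : fdnorm S d) (V : normedModType K) (v : 'I_d -> V) (A B e : R) :
    0 < A -> 0 < B -> A * B <= 1 + e ->
    (forall a, A^-1 * N a <= nvS S (lincomb v a) /\ nvS S (lincomb v a) <= B * N a) ->
  isomorphic (1 + iota S e) [set: fdspace_banach N] (lincomb_span v).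
Proof.
move=> A0 B0 AB vN.
have lcD (x y : 'rV[K]_d) a : lincomb v ((a *: x + y) 0) = a *: lincomb v (x 0) + lincomb v (y 0).
  rewrite /lincomb scaler_sumr -big_split; apply: eq_bigr => i _ /=.
  by rewrite !mxE scalerDl scalerA.
have inj a b : lincomb v a = lincomb v b -> forall i, a i = b i.
  move=> ab i; have [c c0 cP] := fn_lo N.
  have h : N (fun i => a i - b i) <= 0.
    have [+ _] := vN (fun i => a i - b i).
    by rewrite -lincombBr ab subrr nv0 pmulr_rle0 // invr_gt0.
  have l0 : l1norm S (fun i => a i - b i) <= 0.
    by rewrite -(pmulr_rle0 _ c0) (le_trans (cP _)).
  apply/eqP; rewrite -subr_eq0; apply/eqP/(kn0_eq (s := S))/le_anti.
  rewrite kn_ge0 andbT (le_trans _ l0) // /l1norm (bigD1 i) //= lerDl.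
  by apply: sumr_ge0 => j _; apply: kn_ge0.
have [T' T'P] : exists T' : V -> fdspace_banach N,
    forall x, lincomb_span v x -> lincomb v (T' x 0) = x.
  have /choice[T' T'P] : forall x, exists r : fdspace_banach N,
      lincomb_span v x -> lincomb v (r 0) = x.
    move=> x; have [[a ->]|nx] := pselect (lincomb_span v x); last by exists 0.
    by exists (\row_i a i : 'rV_d) => _; congr (lincomb v _); apply/funext => i; rewrite mxE.
  by exists T'.
pose T (r : fdspace_banach N) := lincomb v (r 0).
have TT' r : T' (T r) = r.
  by apply/rowP => i; apply: inj; apply: T'P; exists (r 0).
have TB r : nvS S (T r) <= B * nvS S r.
  by rewrite fdspace_nvE; case: (vN (r 0)).
have T'A x : lincomb_span v x -> nvS S (T' x) <= A * nvS S x.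
  move=> vx; rewrite fdspace_nvE -ler_pdivrMl // -{2}(T'P x vx).
  by case: (vN (T' x 0)).
have [bT T0 TleB] := @opnorm_le _ _ [set: fdspace_banach N] T B (ltW B0) I (fun r _ => TB r).
have sp0 : lincomb_span v 0 by apply/lincomb_spanP; apply: seg0.
have [bT' T'0 T'leA] := opnorm_le (ltW A0) sp0 T'A.
exists T, T'; split=> //.
- by move=> a x y _ _; apply: lcD.
- by move=> r _; split; [exists (r 0)|exact: TT'].
- by move=> x vx; split=> //; exact: T'P.
apply: (le_trans (ler_pM T0 T'0 TleB T'leA)).
by rewrite -rmorphM -(rmorph1 (iota S)) -rmorphD iota_le mulrC.
Qed.

Lemma span_seg (V : normedModType K) (y : nat -> V) s z :
  linear_span [set y i | i in [set i | (s <= i)%N]] z <-> exists n, seg y s n z.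
Proof.
split=> [[m [a [v [vP ->]]]]|[n [a ->]]].
  have [j jP] : exists j : 'I_m -> nat, forall i, (s <= j i)%N /\ y (j i) = v i.
    have /choice[j jP] : forall i : 'I_m, exists k, (s <= k)%N /\ y k = v i.
      by move=> i; have [k /= sk yk] := vP i; exists k.
    by exists j.
  exists (\max_i j i).+1; apply: (@seg_lincomb _ _ y _ _ m v a) => i.
  have [si <-] := jP i; apply: seg_mem; rewrite si ltnS /=.
  exact: (@leq_bigmax _ j i).
have [ns|sn] := leqP n s.
  by exists 0%N, (fun=> 0), (fun=> 0); split=> [[]//|]; rewrite big_geq // big_ord0.
exists (n - s)%N, (fun i => a (i + s)%N), (fun i => y (i + s)%N); split=> [i|].
  by exists (i + s)%N => //=; rewrite leq_addl.
by rewrite -{1}[s]add0n big_addn big_mkord.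
Qed.

Lemma closed_spanE (V : normedModType K) (y : nat -> V) s x :
  closed_span [set y i | i in [set i | (s <= i)%N]] x <-> inspan (nvS S) y s x.
Proof.
split=> [/(closure_nvS S) H e /H[z [/span_seg[n sz] xz]]|H]; first by exists n, z.
apply/(closure_nvS S) => e /H[n [z [sz xz]]]; exists z; split=> //.
by apply/span_seg; exists n.
Qed.

Lemma range_tail (V : Type) (y : nat -> V) :
  range y = [set y i | i in [set i | (0 <= i)%N]].
Proof. by congr image; apply/seteqP; split. Qed.

Lemma inspan_seg (V : normedModType K) (y : nat -> V) s n z :
  seg y s n z -> inspan (nvS S) y s z.
Proof. by move=> sz e e0; exists n, z; split=> //; rewrite subrr nv0 ltW. Qed.

Lemma closed_span_subspace (V : normedModType K) (y : nat -> V) :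
  closed_subspace (closed_span (range y)).
Proof.
rewrite range_tail; split; last exact: closed_closure.
split; first by apply/closed_spanE/(@inspan_seg _ _ _ 0)/seg0.
move=> a u v /closed_spanE Hu /closed_spanE Hv; apply/closed_spanE => e e0.
have ka : 0 <= S a by exact: kn_ge0.
have e1 : 0 < e / (2 * (S a + 1)) by rewrite divr_gt0 // mulr_gt0 //; lra.
have e2 : 0 < e / 2 by rewrite divr_gt0.
have [n [z [sz uz]]] := Hu _ e1; have [m [w [sw vw]]] := Hv _ e2.
exists (maxn n m), (a *: z + w); split.
  by apply: segZD; [apply: seg_incl sz | apply: seg_incl sw]; rewrite ?leq_maxl ?leq_maxr.
have -> : a *: u + v - (a *: z + w) = a *: (u - z) + (v - w).
  by rewrite scalerBr opprD addrACA.
apply: (le_trans (nvD _ _ _)); rewrite nvZ [leRHS]splitr lerD //.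
apply: (@le_trans _ _ (S a * (e / (2 * (S a + 1))))); first exact: ler_wpM2l.
rewrite mulrA ler_pdivrMr ?mulr_gt0 //; last by lra.
by nra.
Qed.

(** If finitely many independent vectors of [E] could not be extended, they would form a finite
    basis of [E]. *)
Lemma free_of_infinite_dim (V : normedModType K) (E : set V) :
  linear_subset E -> infinite_dim E -> exists u : nat -> V, free_seq u /\ forall i, E (u i).
Proof.
move=> [E0 Elin] Einf.
pose inv n (u : nat -> V) := free_upto n u /\ forall i, (i < n)%N -> E (u i).
pose step n (u w : nat -> V) := forall i, (i < n)%N -> w i = u i.
have next n u : inv n u -> exists2 w, inv n.+1 w & step n u w.
  move=> [gu Eu].
  have [x [Ex nx]] : exists x, E x /\ ~ seg u 0 n x.
    apply: contrapT => H; apply: Einf; exists n, (fun i : 'I_n => u i); split.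
      move=> a a0 i; have [c c0 cP] := seg_lower (nvS S) gu.
      pose b j := if insub j is Some i then a i else 0.
      have := cP b; rewrite !big_mkord.
      have -> : \sum_(i < n) b i *: u i = 0.
        by rewrite -[RHS]a0; apply: eq_bigr => j _; rewrite /b valK.
      rewrite nv0 pmulr_rle0 // => h; apply: (kn0_eq (s := S)); apply/le_anti.
      rewrite kn_ge0 andbT (le_trans _ h) // (bigD1 i) //= /b valK lerDl.
      by apply: sumr_ge0 => j _; apply: kn_ge0.
    apply/seteqP; split=> [x|x Ex].
      move=> [m [a [v [vP ->]]]]; apply: (big_ind E) => // [y z Ey Ez|i _].
        by rewrite -(scale1r y); apply: Elin.
      rewrite -[_ *: _]addr0; apply: Elin => //; have [j _ <-] := vP i; exact: Eu.
    have /seg_ord[a ->] : seg u 0 n x.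
      by apply: contrapT => nx; apply: H; exists x.
    by exists n, a, (fun i => u i); split=> // i; exists i.
  exists (fun i => if i == n then x else u i) => [|i ni]; last by rewrite ltn_eqF.
  have segE m z : (m <= n)%N -> seg (fun i => if i == n then x else u i) 0 m z -> seg u 0 m z.
    by move=> mn; apply: seg_eq => j /andP[_ jm]; rewrite ltn_eqF // (leq_trans jm).
  split=> m; rewrite ltnS leq_eqVlt => /orP[/eqP ->|mn]; rewrite ?eqxx ?ltn_eqF //.
  - by move=> /(segE n _ (leqnn n)).
  - by move=> /(segE m _ (ltnW mn)); apply: gu.
  - exact: Eu.
have i0 : inv 0%N (fun=> 0) by split.
have [g g0 gP] := dependent_choice_inv i0 next.
pose u n := g n.+1 n.
have uE n i : (i < n)%N -> g n i = u i.
  elim: n => // n IH; rewrite ltnS leq_eqVlt => /orP[/eqP -> //|ni].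
  by have [_ ->] := gP n; rewrite ?IH.
exists u; split=> [m sm|i]; last by have [[_ Eg] _] := gP i.+1; apply: Eg.
have [[gg _] _] := gP m.+1; apply: (gg m (ltnSn m)).
apply: seg_eq sm => j /andP[_ jm]; rewrite uE //; exact: ltnW.
Qed.

(** A vector in the span of its predecessors would give 0 a second expansion, with coefficient -1 at
    [m]. *)
Lemma free_of_basic (V : normedModType K) (u : nat -> V) : basic_sequence u -> free_seq u.
Proof.
move=> [_ uniq] m [b uE].
have [E0 _] := (closed_span_subspace u).1.
have [a [_ aP]] := uniq 0 E0.
pose c j := if (j < m)%N then b j else if j == m then -1 else 0.
have a0 : a = fun=> 0.
  apply: aP; apply/(cvg_nvS S) => e e0; exists 0%N => k _.
  by rewrite /series /= big1 ?subr0 ?nv0 ?ltW // => j _; rewrite scale0r.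
have ac : a = c.
  apply: aP; apply/(cvg_nvS S) => e e0; exists m.+1 => k mk.
  rewrite /series /= (big_cat_nat _ (n := m.+1)) //= big_nat_recr //=.
  have -> : \sum_(0 <= j < m) c j *: u j = u m.
    by rewrite uE; apply: eq_big_nat => j /andP[_ jm]; rewrite /c jm.
  have -> : \sum_(m.+1 <= j < k) c j *: u j = 0.
    rewrite big_nat big1 // => j /andP[mj _].
    by rewrite /c ltnNge (ltnW mj) /= gtn_eqF // scale0r.
  by rewrite /c ltnn eqxx scaleN1r subrr addr0 subr0 nv0 ltW.
have := congr1 (@^~ m) ac; rewrite a0 /c ltnn eqxx => /eqP.
by rewrite eq_sym oppr_eq0 oner_eq0.
Qed.

(** [block_basis] asks for one coefficient sequence common to all blocks; the separate ones can be
    merged because the index ranges are disjoint. *)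
Lemma glue_coefs (V : lmodType K) (u : nat -> V) d (p : nat -> nat) (v : 'I_d -> V) :
    step_increasing p -> (forall i : 'I_d, seg u (p i) (p i.+1) (v i)) ->
  exists a : nat -> K, forall i : 'I_d, v i = \sum_(p i <= j < p i.+1) a j *: u j.
Proof.
move=> pP /choice[b bP].
have /choice[k kP] : forall j, exists k : option 'I_d, forall i : 'I_d,
    (p i <= j < p i.+1)%N -> k = Some i.
  move=> j; have [[i ij]|H] := pselect (exists i : 'I_d, (p i <= j < p i.+1)%N); last first.
    by exists None => i ij; case: H; exists i.
  exists (Some i) => i' ij'; congr Some; apply: ord_inj.
  move: ij ij' => /andP[h1 h2] /andP[h3 h4]; case: (ltngtP i i') => // lt.
    by have := leq_trans h2 (leq_trans (step_increasing_le pP lt) h3); rewrite ltnn.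
  by have := leq_trans h4 (leq_trans (step_increasing_le pP lt) h1); rewrite ltnn.
exists (fun j => if k j is Some i then b i j else 0) => i; rewrite {1}bP.
by apply: eq_big_nat => j ij; rewrite (kP j i ij).
Qed.

End Assembly.

(** * Saturated bases *)

Section Main.
Context {R : realType} {K : numFieldType} (S : scalars R K).
Context {X : completeNormedModType K}.
Implicit Types (u y : nat -> X).
Let nv := nvS S (V := X).

Lemma schauder_of_basis_bound y (C : R) : 0 <= C -> basis_bound nv C y ->
  (forall i, nv (y i) = 1) -> schauder_basis y (closed_span (range y)).
Proof.
move=> C0 H y1; rewrite range_tail; split=> [i|x /(closed_spanE S) xY].
  apply/(closed_spanE S)/(@inspan_seg _ _ S _ _ _ i.+1)/seg_mem.
  by rewrite leq0n /=.
have [a aP] := coords C0 H y1 xY.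
exists a; split=> [|b /(cvg_nvS S) bP]; first exact/(cvg_nvS S).
apply/funext => i; apply/eqP; rewrite -subr_eq0; apply/eqP/(kn0_eq (s := S))/le_anti.
rewrite kn_ge0 andbT; apply: (@half_le0 _ (4 * C)) => t.
have [M1 M1P] := aP _ (half_gt0 t); have [M2 M2P] := bP _ (half_gt0 t).
pose m := maxn i.+1 (maxn M1 M2).
have im : (0 <= i < m)%N by rewrite leq_max ltnSn.
have := coef_bound (fun i => a i - b i) C0 H im; rewrite y1 mulr1 => h.
apply: (le_trans h).
have -> : \sum_(0 <= j < m) (a j - b j) *: y j =
    \sum_(0 <= j < m) a j *: y j - \sum_(0 <= j < m) b j *: y j.
  by rewrite -sumrB; apply: eq_bigr => j _; rewrite scalerBl.
have h1 := nv_tri nv x (\sum_(0 <= j < m) a j *: y j) (\sum_(0 <= j < m) b j *: y j).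
rewrite (nv_sym nv _ x) in h1.
have h2 : nv (x - \sum_(0 <= j < m) a j *: y j) <= 2^-1 ^+ t.
  by apply: M1P; rewrite !leq_max leqnn ?orbT.
have h3 : nv (x - \sum_(0 <= j < m) b j *: y j) <= 2^-1 ^+ t.
  by apply: M2P; rewrite !leq_max leqnn ?orbT.
have := le_trans h1 (lerD h2 h3); move: (nv _) (_ ^+ t) => A B AB; nra.
Qed.

Lemma basis_constant_of_basis_bound y (C : R) : 0 <= C -> basis_bound nv C y ->
  basis_constant_le y (iota S C).
Proof.
move=> C0 H a x /(cvg_nvS S) ax m.
rewrite !(norm_iotaE S) -rmorphM iota_le -/nv -subr_le0.
apply: (@half_le0 _ C) => t; have [M MP] := ax _ (half_gt0 t).
pose n := maxn m M; have := MP n (leq_maxr _ _); rewrite /series /= -/nv.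
have h : nv (\sum_(i < m) a i *: y i) <= C * nv (\sum_(0 <= i < n) a i *: y i).
  rewrite (big_cat_nat _ (n := m)) ?leq_maxl //= -(big_mkord xpredT (fun i => a i *: y i)).
  by apply: (H m n); eexists.
have := nvB_ge nv (\sum_(0 <= i < n) a i *: y i) x; rewrite nv_sym => h1 h2.
have := ler_wpM2l C0 (le_trans h1 h2); lra.
Qed.

Lemma limit_fdnorm y (D : nat -> nat) (dl : nat -> R) s k d (v : 'I_d -> X) :
    basis_bound nv 2 y -> (forall i, nv (y i) = 1) ->
    (forall t, decided nv (D t) (dl t) (tail t y)) ->
    (forall t, (D t <= D t.+1)%N) -> (forall t, dl t.+1 <= dl t / 2) -> 0 <= dl s ->
    (d <= D s)%N -> tuple_in k (tail s y) v -> admissible nv v ->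
  exists N : fdnorm S d, [/\ forall a, adm_cst d * l1norm S a <= N a,
      forall a, `|nv (lincomb v a) - N a| <= 2 * dl s * l1norm S a &
      forall u, free_seq u -> (forall i, closed_span (range y) (u i)) -> forall e, 0 < e ->
        exists2 v' : 'I_d -> X, tuple_in k u v' &
          forall a, `|nv (lincomb v' a) - N a| <= e * l1norm S a].
Proof.
move=> H y1 dec Dle dlle dl0 dD tv av.
have [N [ND NZ Nlo Nv Nu]] := limit_shape H y1 dec Dle dlle dl0 dD tv av.
have lo : exists2 c : R, 0 < c & forall a, c * l1norm S a <= N a.
  by exists (adm_cst d) => //; apply: adm_cst_gt0.
have up : exists L : R, forall a, N a <= L * l1norm S a.
  exists (2 + 2 * dl s) => a; have := Nv a; rewrite ler_norml => /andP[h _].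
  by have := lincomb_le a av.1; lra.
exists (FdNorm ND NZ lo up); split=> // u gu uY; apply: Nu => // i.
by have := uY i; rewrite range_tail => /(closed_spanE S).
Qed.

(** The factor 4 between [4^-1 ^+ d] and [adm_cst d] is spent here: after an error of one quarter of
    the lower bound, three quarters remain. *)
Lemma admissible_pert d (x v : 'I_d -> X) (t : R) : (forall i, nv (x i) = 1) ->
    (forall a, 4^-1 ^+ d * l1norm S a <= nv (lincomb x a)) ->
    (forall i, nv (x i - v i) <= t) -> t <= adm_cst d -> admissible nv v.
Proof.
move=> x1 xlo xv tc.
have c4 : adm_cst d = 4^-1 ^+ d / 4 :> R by rewrite /adm_cst exprSr.
have d1 : (4^-1 : R) ^+ d <= 1 by apply: exprn_ile1; lra.
have d0 : 0 < (4^-1 : R) ^+ d by apply: exprn_gt0; lra.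
split=> [i|a].
  by have := nvB_ge nv (v i) (x i); rewrite nv_sym x1; have := xv i; lra.
have := lincomb_pert a xv; rewrite ler_norml => /andP[_ h].
have l0 := l1norm_ge0 (kn := S) a; have := xlo a; have := ler_wpM2r l0 tc.
rewrite c4; move: h; move: (_ ^+ d) d0 (l1norm _ _) l0 (nv _) (nv _) => P P0 L L0 A B.
have : 0 <= P * L by rewrite mulr_ge0 // ltW.
lra.
Qed.

Theorem saturated_basis (hX : infinite_dim [set: X])
  (e : nat -> K) (e_gt0 : forall n, 0 < e n) (f : nat -> nat) :
  exists (Y : set X) (y : nat -> X),
    [/\ closed_subspace Y,
        [/\ schauder_basis y Y,
            (forall i, `|y i| = 1) &
            basis_constant_le y (1 + e 0%N)],
        forall n, (0 < n)%N ->
          forall E : set X, closed_subspace E ->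
            E `<=` closed_span [set y i | i in [set i | (n.-1 <= i)%N]] ->
            dim_le E (f n) ->
            exists F : completeNormedModType K,
              isomorphic (1 + e n) E [set: F] /\
              forall W : set X, closed_subspace W -> W `<=` Y -> infinite_dim W ->
                almost_isometrically_embeds [set: F] W &
        forall n, (0 < n)%N ->
          forall z : 'I_(f n) -> X,
            block_basis (fun i => y (n.-1 + i)%N) z ->
            exists (F : completeNormedModType K) (w : 'I_(f n) -> F),
              [/\ finite_basis w [set: F],
                  seq_equivalent (1 + e n) z w &
                  forall u : nat -> X, (forall i, Y (u i)) ->
                    basic_sequence u ->
                    almost_isometrically_equivalent_to_block w u]].
Proof.
have se n : 0 < S (e n) by exact: skn_gt0.
(* At most [S (e 0)] and at most 1; the latter gives the basis constant 2 on which all later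
   constants rely. *)
pose eta := S (e 0%N) / (1 + S (e 0%N)).
have e01 : 0 < 1 + S (e 0%N) by have := se 0%N; lra.
have eta0 : 0 < eta by rewrite divr_gt0.
have eta1 : eta <= 1 by rewrite ler_pdivrMr //; lra.
have eta_e : eta <= S (e 0%N).
  rewrite ler_pdivrMr // mulrDr mulr1 lerDl; apply: mulr_ge0; exact: ltW.
(* A nondecreasing bound for the lengths. Stage [s] serves [n = s.+1], since the tail of [y] from
   index [s] starts at the [n]-th basis vector. *)
pose D s := (\sum_(t < s.+2) f t)%N.
have Dle t : (D t <= D t.+1)%N by rewrite /D [leqRHS]big_ord_recr /= leq_addr.
have fD s : (f s.+1 <= D s)%N by rewrite /D big_ord_recr /= leq_addl.
(* A quarter of the admissible error: clause (2) spends [3 * g s] (moving into the finite span, then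
   the limit), clause (3) spends [2 * g s]. *)
pose g s : R := slack (S (e s.+1)) * adm_cst (D s) / 4.
have g0 s : 0 < g s by rewrite divr_gt0 // mulr_gt0 ?slack_gt0 // adm_cst_gt0.
pose dl := fix dl s : R := if s is t.+1 then Num.min (dl t / 2) (g s) else g 0%N.
have dl0 s : 0 < dl s by elim: s => [|s IH] /=; rewrite ?lt_min ?g0 ?divr_gt0.
have dlg s : dl s <= g s by case: s => [|s] //=; rewrite ge_min lexx orbT.
have dlle s : dl s.+1 <= dl s / 2 by rewrite /= ge_min lexx.
have [u0 [gu0 _]] := free_of_infinite_dim S (ltac:(by []) : linear_subset [set: X]) hX.
have [y [y1 Hy dec]] := saturated nv D gu0 eta0 dl0.
have H2 : basis_bound nv 2 y.
  move=> m n x z sx sz; apply: (le_trans (Hy _ _ _ _ sx sz)).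
  by rewrite ler_wpM2r ?nv_ge0 //; lra.
have y0 i : y i <> 0 by move=> h; have := y1 i; rewrite h nv0; lra.
have Hlim s k d (v : 'I_d -> X) := @limit_fdnorm y D dl s k d v H2 y1 dec Dle dlle (ltW (dl0 s)).
have slack1 (r : R) : 0 < r -> slack r <= 1.
  by move=> r0; have := slackE r0; have := slack_gt0 r0; nra.
have g_cst s d : (d <= f s.+1)%N -> 4 * g s <= slack (S (e s.+1)) * adm_cst d.
  move=> df; rewrite /g mulrC divfK // ler_pM2l ?slack_gt0 //.
  by apply: adm_cst_le; apply: leq_trans df (fD s).
have g_le s d : (d <= f s.+1)%N -> g s <= adm_cst d.
  move=> /g_cst h; have := slack1 _ (se s.+1); have := adm_cst_gt0 (R := R) d; have := g0 s; nra.
have e_iota n : 1 + e n = 1 + iota S (S (e n)) by rewrite skn_pos // ltW.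
exists (closed_span (range y)), y; split.
- exact: (closed_span_subspace S).
- split.
  + by apply: schauder_of_basis_bound H2 y1.
  + by move=> i; rewrite (norm_iotaE S) -/nv y1 rmorph1.
  + move=> a x ax m; apply: (le_trans (basis_constant_of_basis_bound _ Hy ax m)); first by lra.
    by rewrite ler_wpM2r // e_iota rmorphD rmorph1 lerD2l iota_le.
- move=> [//|s] _ E cE Etail [k kf [b [bind bE]]] /=.
  have [x [xE x1 xlo]] : exists x : 'I_k -> X, [/\ lincomb_span x = E, forall i, nv (x i) = 1 &
      forall a, 4^-1 ^+ k * l1norm S a <= nv (lincomb x a)].
    (* Linear independence of [b] in triangular form; a dependence yields a vanishing combination
       with coefficient -1 at [m] and 0 beyond. *)
    have gb : free_upto k (ext_ord b).
      move=> m mk [a aE].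
      pose c' i := if (i < m)%N then a i else if i == m then -1 else 0.
      pose c (i : 'I_k) := c' i.
      have c0 : \sum_(i < k) c i *: b i = 0.
        rewrite (eq_bigr (fun i : 'I_k => c' i *: ext_ord b i)) => [|i _]; last by rewrite ext_ordE.
        rewrite -(big_mkord xpredT (fun i => c' i *: ext_ord b i)).
        rewrite (big_cat_nat _ (n := m)) ?(ltnW mk) //= (big_ltn mk).
        have -> : \sum_(0 <= i < m) c' i *: ext_ord b i = ext_ord b m.
          by rewrite aE; apply: eq_big_nat => i /andP[_ im]; rewrite /c' im.
        have -> : \sum_(m.+1 <= i < k) c' i *: ext_ord b i = 0.
          rewrite big_nat big1 // => i /andP[mi _].
          by rewrite /c' ltnNge (ltnW mi) /= gtn_eqF // scale0r.
        by rewrite /c' ltnn eqxx scaleN1r addr0 subrr.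
      have /eqP := bind c c0 (Ordinal mk); rewrite /c /c' /= ltnn eqxx.
      by rewrite oppr_eq0 oner_eq0.
    have [x [x1 xb xlo]] := riesz_basis nv gb.
    exists (fun i => x i); split=> [|i|a]; first last.
    - have := xlo (fun j => if insub j is Some i then a i else 0).
      rewrite !big_mkord (eq_bigr (fun i => S (a i))) => [|i _]; last by rewrite valK.
      by rewrite (eq_bigr (fun i : 'I_k => a i *: x i)) // => i _; rewrite valK.
    - by case: (x1 i (ltn_ord i)).
    have bE' z : E z <-> seg (ext_ord b) 0 k z.
      rewrite -lincomb_spanP -bE; split=> [[m [a [v [vP ->]]]]|[a ->]].
        apply/lincomb_spanP; apply: (@seg_lincomb _ _ (ext_ord b) 0 k m v a) => i.
        by have [j _ <-] := vP i; rewrite -ext_ordE; apply: seg_mem; exact: ltn_ord.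
      by exists k, a, b; split=> // i; exists i.
    apply/seteqP; split=> z; rewrite bE'.
      move=> [a ->]; apply: seg_lincomb => i; have [sx _] := x1 i (ltn_ord i).
      by apply: seg_incl sx.
    by move=> /(xb _ _ (leqnn k)) /seg_ord.
  have Ex i : E (x i).
    rewrite -xE; apply/lincomb_spanP; rewrite -ext_ordE; apply: seg_mem; exact: ltn_ord.
  (* Vectors of [E] lie only in the closed span of the tail, whereas deciding concerns finite
     combinations; nearby vectors [v i] replace the basis of [E]. *)
  have /choice[nz nzP] : forall i, exists nz : nat * X, seg y s nz.1 nz.2 /\ nv (x i - nz.2) <= g s.
    move=> i; have /(closed_spanE S) h := Etail _ (Ex i).
    by have [n [z h']] := h _ (g0 s); exists (n, z).
  pose v i := (nz i).2.
  have av : admissible nv v.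
    by apply: (admissible_pert x1 xlo) (g_le s k kf) => i; case: (nzP i).
  have tv : tuple_in true (tail s y) v.
    (* For arbitrary tuples only the right ends [p i.+1] matter: the maximum covers all supports,
       and adding [j] makes the sequence strictly increasing. *)
    exists (fun j => \max_i (nz i).1 + j)%N => [j|i]; first by rewrite ltn_add2l.
    apply/seg_tail; rewrite addn0; have [sz _] := nzP i; apply: seg_incl sz => //.
    by rewrite addnCA (leq_trans _ (leq_addr _ _)) // (leq_bigmax i).
  have [N [Nlo Nv Nu]] := Hlim s true k v (leq_trans kf (fD s)) tv av.
  exists (fdspace_banach N); split.
    have xN a : `|nv (lincomb x a) - N a| <= 3 * g s * l1norm S a.
      have h1 := lincomb_pert a (fun i => (nzP i).2); have h2 := Nv a.
      have h3 := ler_wpM2r (l1norm_ge0 (kn := S) a) (dlg s).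
      by move: h1 h2; rewrite !ler_norml => /andP[? ?] /andP[? ?]; apply/andP; split; lra.
    have tc : 3 * g s <= slack (S (e s.+1)) * adm_cst k by have := g_cst s k kf; have := g0 s; lra.
    have [A [B [A0 B0 AB hAB]]] := equivalent_of_close (adm_cst_gt0 k) (se s.+1) tc Nlo xN.
    by rewrite e_iota -xE; apply: isomorphic_sym => //; apply: fdspace_iso A0 B0 AB hAB.
  move=> W [Wlin _] WY Winf t t0.
  have [u [gu uW]] := free_of_infinite_dim S Wlin Winf.
  have st := skn_gt0 S t0; have ck := adm_cst_gt0 (R := R) k.
  have q0 : 0 < slack (S t) * adm_cst k by rewrite mulr_gt0 // slack_gt0.
  have [v' [p _ v'u] v'N] := Nu u gu (fun i => WY _ (uW i)) _ q0.
  have [A [B [A0 B0 AB hAB]]] := equivalent_of_close ck st (lexx _) Nlo v'N.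
  exists (lincomb_span v'); split.
  + have Ac : 0 < A^-1 * adm_cst k by rewrite mulr_gt0 // invr_gt0.
    apply: (lincomb_span_closed Ac) => a; have [h _] := hAB a; apply: le_trans h.
    by rewrite -mulrA ler_pM2l // invr_gt0.
  + move=> _ [a ->]; have [W0 WD] := Wlin.
    have vW i : W (v' i) by apply: (seg_sub W0 WD) (v'u i) => j _; apply: uW.
    apply: (big_ind W) => // [z1 z2 h1 h2|i _]; first by rewrite -(scale1r z1); apply: WD.
    by rewrite -[_ *: _]addr0; apply: WD.
  + by rewrite -(skn_pos S (ltW t0)); apply: fdspace_iso A0 B0 AB hAB.
- move=> [//|s] _ z [p [a [pP zP]]] /=; set d := f s.+1 in z zP *.
  rewrite /= in zP.
  have z0 i : z i <> 0 by case: (zP i) => _ /eqP.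
  (* The shape is taken from the normalized blocks; the lengths [c i] are put back into [w] and into
     the approximating blocks. *)
  pose c i : K := `|z i|.
  have c0 i : c i != 0 by rewrite normr_eq0; apply/eqP.
  pose v i := (c i)^-1 *: z i.
  have zv i : z i = c i *: v i by rewrite scalerA divff // scale1r.
  have vs (i : 'I_d) : seg (tail s y) (p i) (p i.+1) (v i).
    by apply: segZ; case: (zP i) => -> _; exists a.
  have v1 i : nv (v i) = 1.
    apply: (@iota_inj _ _ S (nv (v i)) 1).
    rewrite -norm_iotaE normrZ normfV /c normr_id mulVf ?rmorph1 //.
    exact: c0.
  have v0 i : v i <> 0 by move=> h; have := v1 i; rewrite h nv0; lra.
  have av : admissible nv v.
    (* The finite block family is completed to an infinite block sequence by taking the first basis
       vector of each further interval. *)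
    pose v' j := if insub j is Some i then v i else y (s + p j)%N.
    apply: (@admissible_blk _ _ _ _ nv y v') => //; rewrite /v'.
      apply: (blk_of_tail (P := s)); exists p; split=> // j; case: insubP => [i _ <-|_].
        by split; [exact: vs|exact: v0].
      split; last exact: y0.
      by apply: (@seg_mem _ _ (tail s y)); rewrite leqnn pP.
    by move=> i; rewrite valK.
  have tv : tuple_in false (tail s y) v by exists p.
  have [N [Nlo Nv Nu]] := Hlim s false d v (fD s) tv av.
  pose F := fdspace_banach N.
  pose w (i : 'I_d) : F := (c i *: delta_mx 0 i : 'rV[K]_d).
  have wE b : \sum_i b i *: w i = (\row_i (b i * c i) : 'rV[K]_d) :> F.
    apply/rowP => j; rewrite mxE summxE (bigD1 j) //= big1 ?addr0 => [|i ij].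
      by rewrite !mxE !eqxx mulr1.
    by rewrite !mxE (eq_sym j) (negbTE ij) andbF !mulr0.
  have wN b : `|\sum_i b i *: w i| = iota S (N (fun i => b i * c i)).
    rewrite wE (norm_iotaE S) fdspace_nvE; congr (iota S (N _)).
    by apply/funext => i; rewrite mxE.
  have cE (v' : 'I_d -> X) b :
      `|\sum_i b i *: (c i *: v' i)| = iota S (nv (lincomb v' (fun i => b i * c i))).
    rewrite (norm_iotaE S) -/nv; congr (iota S (nv _)).
    by apply: eq_bigr => i _; rewrite scalerA.
  have equiv (v' : 'I_d -> X) (r t : R) : 0 < r -> t <= slack r * adm_cst d ->
      (forall b, `|nv (lincomb v' b) - N b| <= t * l1norm S b) ->
      seq_equivalent (1 + iota S r) (fun i => c i *: v' i) w.
    move=> r0 tc v'N.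
    have [A [B [A0 B0 AB hAB]]] := equivalent_of_close (adm_cst_gt0 d) r0 tc Nlo v'N.
    exists (iota S A), (iota S B); rewrite !iota_gt0; split=> //.
      by rewrite -rmorphM -(rmorph1 (iota S)) -rmorphD iota_le.
    move=> b; rewrite wN cE -fmorphV -!rmorphM !iota_le; exact: hAB.
  exists F, w; split.
  + split=> [b b0 i|].
      have := congr1 (fun r : 'rV[K]_d => r 0 i) (etrans (esym (wE b)) b0).
      by rewrite !mxE => /eqP; rewrite mulf_eq0 (negbTE (c0 i)) orbF => /eqP.
    apply/seteqP; split=> // r _; exists d, (fun i => (r : 'rV[K]_d) 0 i / c i), w.
    split=> [i|]; first by exists i.
    by rewrite wE; apply/rowP => i; rewrite mxE divfK.
  + have -> : z = fun i => c i *: v i by apply/funext => i; rewrite -zv.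
    rewrite e_iota; apply: (equiv v _ (2 * g s)) => // [|b].
      by have := g_cst s d (leqnn _); have := g0 s; lra.
    by apply: (le_trans (Nv b)); rewrite ler_wpM2r ?l1norm_ge0 // ler_pM2l.
  move=> u uY bu t t0; have st := skn_gt0 S t0; have cd := adm_cst_gt0 (R := R) d.
  have q0 : 0 < slack (S t) * adm_cst d by rewrite mulr_gt0 // slack_gt0.
  have [v' [q qP v'u] v'N] := Nu u (free_of_basic S bu) uY _ q0.
  exists (fun i => c i *: v' i); split; last first.
    by rewrite -(skn_pos S (ltW t0)); apply: equiv v'N.
  have [b bP] := glue_coefs qP (fun i => segZ (c i) (v'u i)).
  exists q, b; split=> // i; split=> //.
  have [A [B [A0 B0 AB hAB]]] := equivalent_of_close cd st (lexx _) Nlo v'N.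
  (* The approximating vectors must be nonzero to be blocks: on the [i]-th unit vector the limit
     norm is positive, so a zero [v' i] would violate the equivalence. *)
  rewrite scaler_eq0 negb_or c0; apply/eqP => v'0.
  have [h _] := hAB (fun j => (j == i)%:R); move: h.
  have -> : lincomb v' (fun j => (j == i)%:R) = v' i.
    rewrite /lincomb (bigD1 i) //= eqxx scale1r big1 ?addr0 // => j ji.
    by rewrite (negbTE ji) scale0r.
  have l1p : 0 < l1norm S (fun j : 'I_d => (j == i)%:R).
    rewrite /l1norm (bigD1 i) //= eqxx kn1 ltr_pwDl // sumr_ge0 // => j _; exact: kn_ge0.
  have := Nlo (fun j => (j == i)%:R); rewrite v'0 nv0 pmulr_rle0 ?invr_gt0 //.
  have := mulr_gt0 cd l1p; lra.
Qed.

End Main.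

(* y k stands for the (k+1)-st basis vector: for n >= 1 the tail starting at
   the n-th vector is the sequence y n.-1, y n, ... *)
Theorem theorem6p1 (R : realType) (K : numFieldType)
  (hK : real_or_complex R K)
  (X : completeNormedModType K) (hX : infinite_dim [set: X])
  (e : nat -> K) (e_gt0 : forall n, 0 < e n)
  (e_decr : forall m n, (m <= n)%N -> e n <= e m)
  (e_cvg : e n @[n --> \oo] --> (0 : K))
  (f : nat -> nat) (f_gt0 : forall n, (0 < n)%N -> (0 < f n)%N) :
  exists (Y : set X) (y : nat -> X),
    [/\ closed_subspace Y,
        [/\ schauder_basis y Y,
            (forall i, `|y i| = 1) &
            basis_constant_le y (1 + e 0%N)],
        forall n, (0 < n)%N ->
          forall E : set X, closed_subspace E ->
            E `<=` closed_span [set y i | i in [set i | (n.-1 <= i)%N]] ->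
            dim_le E (f n) ->
            exists F : completeNormedModType K,
              isomorphic (1 + e n) E [set: F] /\
              forall W : set X, closed_subspace W -> W `<=` Y -> infinite_dim W ->
                almost_isometrically_embeds [set: F] W &
        forall n, (0 < n)%N ->
          forall z : 'I_(f n) -> X,
            block_basis (fun i => y (n.-1 + i)%N) z ->
            exists (F : completeNormedModType K) (w : 'I_(f n) -> F),
              [/\ finite_basis w [set: F],
                  seq_equivalent (1 + e n) z w &
                  forall u : nat -> X, (forall i, Y (u i)) ->
                    basic_sequence u ->
                    almost_isometrically_equivalent_to_block w u]].
Proof.
have [S] : inhabited (scalars R K).
  by case: K / hK {X hX e e_gt0 e_decr e_cvg}; [exact: real_scalars|exact: complex_scalars].
exact: (saturated_basis S).
Qed.
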